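(* Let $R=\bigoplus_{n\ge 0}R_{n}$ be a graded commutative Noetherian ring whose base ring $R_{0}$ is a commutative Noetherian local ring with maximal ideal $\mathfrak{m}_{0}$. Let $\mathfrak{a}_{0}$ be a proper ideal of $R_{0}$, let $R_{+}=\bigoplus_{n>0}R_{n}$, and let $\mathfrak{a}=\mathfrak{a}_{0}+R_{+}$. Let $\mathfrak{b}_{0}$ be an ideal of $R_{0}$ such that $\mathfrak{a}_{0}+\mathfrak{b}_{0}$ is an $\mathfrak{m}_{0}$-primary ideal. Let $T$ be an $\mathfrak{a}$-torsion graded minimax $R$-module. Then $H^{i}_{\mathfrak{b}_{0}}(T)$ and $\operatorname{Tor}^{R_{0}}_{i}(R_{0}/\mathfrak{b}_{0},T)$ are Artinian $R$-modules for all $i\ge 0$.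
   Context: Here $\mathfrak{a}=\mathfrak{a}_{0}+R_{+}$ denotes the ideal $\mathfrak{a}_{0}R+R_{+}$ of $R$. $H^{i}_{\mathfrak{b}_{0}}(T)$ is the ordinary local cohomology of $T$ with respect to $\mathfrak{b}_{0}$ (equivalently with respect to $\mathfrak{b}_{0}R$), which carries a natural $R$-module structure, as does $\operatorname{Tor}^{R_{0}}_{i}(R_{0}/\mathfrak{b}_{0},T)$. An $R$-module $T$ is $\mathfrak{a}$-torsion if $\Gamma_{\mathfrak{a}}(T)=T$, i.e. every element of $T$ is annihilated by some power of $\mathfrak{a}$. An $R$-module $T$ is minimax if there is a finitely generated submodule $L$ of $T$ such that $T/L$ is an Artinian $R$-module. *)

(* Defs.v *)
From HB Require Import structures.
From mathcomp Require Import all_boot all_algebra boolp classical_sets.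
From mathcomp Require Import finmap monalg.

Set Implicit Arguments.
Unset Strict Implicit.
Unset Printing Implicit Defensive.

Import GRing.Theory.
Local Open Scope ring_scope.
Local Open Scope quotient_scope.

(* A submodule is a boolean predicate of type [submodClosed M]. As
   [`[< P >] : bool] is equivalent to [P : Prop] for every [P], these are all
   the submodules in the usual sense. *)

Notation ideal A := (submodClosed A^o).

Section Submodules.
Variable R : comNzRingType.

Section SubmoduleType.
Variables (M : lmodType R) (N : submodClosed M).

(* [submodClosed] does not inherit from [zmodClosed], which both subtypes and
   quotients require; this copy of [N] carries the two structures. *)
Definition submod_pred : {pred M} := N.

Lemma submod_pred_closed : submod_closed submod_pred.
Proof. exact: submodClosedP. Qed.

HB.instance Definition _ :=
  GRing.isSubmodClosed.Build R M submod_pred submod_pred_closed.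

Record submodule := Submod { submod_val : M; _ : submod_val \in submod_pred }.

HB.instance Definition _ := [isSub for submod_val].
HB.instance Definition _ := [Choice of submodule by <:].
HB.instance Definition _ := [SubChoice_isSubLmodule of submodule by <:].

Definition quotmod : Type := (Quotient.quot submod_pred).

HB.instance Definition _ := GRing.Zmodule.on quotmod.

Definition quotmod_pi (x : M) : quotmod := \pi_(Quotient.quot submod_pred) x.

Definition quotmod_repr (x : quotmod) : M :=
  repr (x : Quotient.quot submod_pred).

Definition quotmod_scale (a : R) (x : quotmod) : quotmod :=
  quotmod_pi (a *: quotmod_repr x).

Lemma quotmod_piP x y : (quotmod_pi x = quotmod_pi y) <-> (x - y \in N).
Proof.
by split=> [/eqP|xy]; [|apply/eqP]; rewrite /quotmod_pi piE Quotient.equivE.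
Qed.

Lemma quotmod_reprK x : quotmod_pi (quotmod_repr x) = x.
Proof. exact: reprK. Qed.

Lemma quotmod_piD x y : quotmod_pi (x + y) = quotmod_pi x + quotmod_pi y.
Proof. by rewrite /quotmod_pi raddfD. Qed.

Lemma quotmod_piZ a x : quotmod_pi (a *: x) = quotmod_scale a (quotmod_pi x).
Proof.
apply/quotmod_piP; rewrite -scalerBr rpredZ //.
by apply/quotmod_piP; rewrite quotmod_reprK.
Qed.

Lemma quotmod_scaleA a b x :
  quotmod_scale a (quotmod_scale b x) = quotmod_scale (a * b) x.
Proof. by rewrite -[x]quotmod_reprK -!quotmod_piZ scalerA. Qed.

Lemma quotmod_scale1 : left_id 1 quotmod_scale.
Proof. by move=> x; rewrite -[x]quotmod_reprK -!quotmod_piZ scale1r. Qed.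

Lemma quotmod_scaleDr : right_distributive quotmod_scale +%R.
Proof.
move=> a x y; rewrite -[x]quotmod_reprK -[y]quotmod_reprK.
by rewrite -quotmod_piD -!quotmod_piZ scalerDr quotmod_piD.
Qed.

Lemma quotmod_scaleDl x : {morph quotmod_scale^~ x : a b / a + b}.
Proof.
move=> a b; rewrite -[x]quotmod_reprK -!quotmod_piZ -quotmod_piD.
by rewrite scalerDl.
Qed.

HB.instance Definition _ := GRing.Zmodule_isLmodule.Build R quotmod
  quotmod_scaleA quotmod_scale1 quotmod_scaleDr quotmod_scaleDl.

Lemma quotmod_pi_linear : linear quotmod_pi.
Proof. by move=> a x y; rewrite quotmod_piD quotmod_piZ. Qed.

HB.instance Definition _ := GRing.isLinear.Build R M quotmod *:%R quotmod_pi
  quotmod_pi_linear.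

End SubmoduleType.

Section Span.
Variables (M : lmodType R) (A : set M).

Definition mod_span : {pred M} :=
  [pred x | `[< forall N : submodClosed M,
                  (forall y, A y -> y \in N) -> x \in N >]].

Lemma span_closed : submod_closed mod_span.
Proof.
split=> [|a x y]; rewrite !inE; first by apply/asboolP => N _; exact: rpred0.
move=> /asboolP xS /asboolP yS; apply/asboolP => N AN.
by rewrite rpredD ?rpredZ ?xS ?yS.
Qed.

HB.instance Definition _ := GRing.isSubmodClosed.Build R M mod_span span_closed.
End Span.

Section Homology.
Variables (L M N : lmodType R) (f : {linear L -> M}) (g : {linear M -> N}).

Definition kernel : {pred M} := [pred x | g x == 0].

Lemma kernel_closed : submod_closed kernel.
Proof.
split=> [|a x y]; rewrite !inE ?linear0 // => /eqP gx /eqP gy.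
by rewrite linearP gx gy scaler0 addr0.
Qed.

HB.instance Definition _ := GRing.isSubmodClosed.Build R M kernel kernel_closed.

Definition im_in_kernel : {pred submodule kernel} :=
  [pred x | `[< exists y, f y = submod_val x >]].

Lemma im_in_kernel_closed : submod_closed im_in_kernel.
Proof.
split=> [|a x y]; rewrite !inE.
  by apply/asboolP; exists 0; rewrite linear0.
move=> /asboolP[u fu] /asboolP[v fv]; apply/asboolP; exists (a *: u + v).
by rewrite linearP fu fv.
Qed.

HB.instance Definition _ :=
  GRing.isSubmodClosed.Build R (submodule kernel) im_in_kernel
    im_in_kernel_closed.

(* Used only when [g \o f = 0]: then it is ker g / im f. *)
Definition homology : lmodType R := quotmod im_in_kernel.
End Homology.

Definition fin_gen_submod (M : lmodType R) (N : submodClosed M) : Prop :=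
  exists s : seq M, N =i mod_span [set x | x \in s].

Definition noetherian_module (M : lmodType R) : Prop :=
  forall N : submodClosed M, fin_gen_submod N.

Definition artinian_module (M : lmodType R) : Prop :=
  forall N : nat -> submodClosed M,
    (forall n, {subset N n.+1 <= N n}) ->
    exists n, forall m, (n <= m)%N -> N m =i N n.

Definition minimax_module (M : lmodType R) : Prop :=
  exists L : submodClosed M, fin_gen_submod L /\ artinian_module (quotmod L).

Definition injective_module (E : lmodType R) : Prop :=
  forall (M N : lmodType R) (f : {linear M -> N}) (g : {linear M -> E}),
    injective f -> exists h : {linear N -> E}, forall x, h (f x) = g x.

Definition projective_module (P : lmodType R) : Prop :=
  forall (M N : lmodType R) (f : {linear M -> N}) (g : {linear P -> N}),
    (forall y, exists x, f x = y) ->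
    exists h : {linear P -> M}, forall x, f (h x) = g x.

Definition exact_at (L M N : lmodType R)
    (f : {linear L -> M}) (g : {linear M -> N}) : Prop :=
  forall y, g y = 0 <-> exists x, f x = y.

Record injective_resolution (M : lmodType R) := InjectiveResolution {
  ires_obj :> nat -> lmodType R;
  ires_aug : {linear M -> ires_obj 0};
  ires_d : forall n, {linear ires_obj n -> ires_obj n.+1};
  ires_inj : forall n, injective_module (ires_obj n);
  ires_aug_inj : injective ires_aug;
  ires_exact0 : exact_at ires_aug (ires_d 0);
  ires_exact : forall n, exact_at (ires_d n) (ires_d n.+1)
}.

Record projective_resolution (M : lmodType R) := ProjectiveResolution {
  pres_obj :> nat -> lmodType R;
  pres_aug : {linear pres_obj 0 -> M};
  pres_d : forall n, {linear pres_obj n.+1 -> pres_obj n};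
  pres_proj : forall n, projective_module (pres_obj n);
  pres_aug_surj : forall y, exists x, pres_aug x = y;
  pres_exact0 : exact_at (pres_d 0) pres_aug;
  pres_exact : forall n, exact_at (pres_d n.+1) (pres_d n)
}.

End Submodules.

Section Ideals.
Variable R : comNzRingType.
Implicit Types I J m : ideal R.

Definition ideal_mul I J : ideal R :=
  mod_span (M := R^o)
    [set z | exists x y, [/\ x \in I, y \in J & z = x * y]]%classic.

Fixpoint ideal_exp I n : ideal R :=
  if n is n'.+1 then ideal_mul I (ideal_exp I n')
  else mod_span (M := R^o) [set 1]%classic.

Section Sum.
Variables I J : ideal R.

Definition ideal_add : {pred R^o} :=
  [pred z | `[< exists x y, [/\ x \in I, y \in J & z = x + y] >]].

Lemma ideal_add_closed : submod_closed ideal_add.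
Proof.
split=> [|a x y]; rewrite !inE.
  by apply/asboolP; exists 0, 0; rewrite !rpred0 addr0.
move=> /asboolP[x1 [x2 [x1I x2J ->]]] /asboolP[y1 [y2 [y1I y2J ->]]].
apply/asboolP; exists (a *: x1 + y1), (a *: x2 + y2).
by rewrite !rpredD ?rpredZ // scalerDr addrACA.
Qed.

HB.instance Definition _ :=
  GRing.isSubmodClosed.Build R R^o ideal_add ideal_add_closed.
End Sum.

Definition is_proper_ideal I : Prop := (1 : R^o) \notin I.

Definition maximal_ideal m : Prop :=
  is_proper_ideal m /\ forall I, is_proper_ideal I -> {subset m <= I} -> I =i m.

(* [m] is the unique maximal ideal of [R]. *)
Definition local_with m : Prop :=
  maximal_ideal m /\ forall I, maximal_ideal I -> I =i m.

Definition primary_ideal I : Prop :=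
  is_proper_ideal I /\
  forall x y : R, x * y \in I -> x \in I \/ exists n, y ^+ n \in I.

(* [I] is primary with radical [m]. *)
Definition primary_to m I : Prop :=
  primary_ideal I /\
  forall x : R, x \in m <-> exists n, x ^+ n \in I.

Definition noetherian_ring : Prop := noetherian_module R^o.

Lemma ideal_exp_subset I k n :
  {subset ideal_exp I (k + n) <= ideal_exp I n}.
Proof.
elim: k => // k IH x xI; apply: IH; move: xI; rewrite addSn /= /ideal_mul.
rewrite inE => /asboolP; apply=> _ [y [z [_ zI ->]]].
exact: (rpredZ (y : R)).
Qed.

Section Torsion.
Variable I : ideal R.

Section TorsionSubmodule.
Variable M : lmodType R.

Definition torsion : {pred M} :=
  [pred x | `[< exists n, forall r : R, r \in ideal_exp I n -> r *: x = 0 >]].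

Lemma torsion_closed : submod_closed torsion.
Proof.
split=> [|a x y]; rewrite !inE.
  by apply/asboolP; exists 0 => r _; rewrite scaler0.
move=> /asboolP[m xm] /asboolP[n yn]; apply/asboolP; exists (m + n)%N => r rI.
rewrite scalerDr scalerA mulrC -scalerA yn ?(ideal_exp_subset rI) //.
rewrite xm ?scaler0 ?addr0 //; move: rI; rewrite addnC.
exact: ideal_exp_subset.
Qed.

HB.instance Definition _ :=
  GRing.isSubmodClosed.Build R M torsion torsion_closed.

Definition Gamma : lmodType R := submodule torsion.

Definition torsion_module : Prop := forall x : M, x \in torsion.
End TorsionSubmodule.

Section TorsionMap.
Variables (M N : lmodType R) (f : {linear M -> N}).

Lemma Gamma_map_subproof (x : Gamma M) :
  f (submod_val x) \in submod_pred (@torsion N).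
Proof.
case: x => x /=; rewrite !inE => /asboolP[n xn]; apply/asboolP.
exists n => r rI; by rewrite -linearZ xn ?linear0.
Qed.

Definition Gamma_map (x : Gamma M) : Gamma N := Submod (Gamma_map_subproof x).

Lemma Gamma_map_linear : linear Gamma_map.
Proof. by move=> a x y; apply: val_inj; rewrite /= linearP. Qed.

HB.instance Definition _ :=
  GRing.isLinear.Build R (Gamma M) (Gamma N) *:%R Gamma_map Gamma_map_linear.
End TorsionMap.

(* The [i]-th right derived functor of [Gamma] at [M], computed from the
   injective resolution [E] of [M]. *)
Definition local_cohomology (M : lmodType R) (E : injective_resolution M)
    (i : nat) : lmodType R :=
  if i is j.+1
  then homology (Gamma_map (ires_d E j)) (Gamma_map (ires_d E j.+1))
  else homology (\0 : {linear Gamma (E 0) -> Gamma (E 0)})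
                (Gamma_map (ires_d E 0)).
End Torsion.
End Ideals.

Section Extension.
Variables (A B : comNzRingType) (phi : {rmorphism A -> B}).

Definition ideal_ext (I : ideal A) : ideal B :=
  mod_span (M := B^o) [set phi a | a in [set a | a \in I]]%classic.
End Extension.

Section FreeModule.
Variables (R : comNzRingType) (K : choiceType).

Definition free_module : lmodType R := {malg R[K]}.

Definition free_gen (k : K) : free_module := << k >>.

Section Lift.
Variables (M : lmodType R) (h : K -> M).

(* The linear extension of [h]. *)
Definition free_lift (g : free_module) : M :=
  \sum_(k <- msupp (g : {malg R[K]})) (g : {malg R[K]})@_k *: h k.

Lemma free_liftEw (g : {malg R[K]}) (d : {fset K}) :
  (msupp g `<=` d)%fset -> free_lift g = \sum_(k <- d) g@_k *: h k.
Proof.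
move=> gd; rewrite /free_lift; apply/big_fset_incl => // k _ kg.
by rewrite mcoeff_outdom // scale0r.
Qed.

Lemma free_lift_linear : linear free_lift.
Proof.
move=> a x y.
set d := (msupp (x : {malg R[K]}) `|` msupp (y : {malg R[K]}))%fset.
rewrite (@free_liftEw x d) ?fsubsetUl // (@free_liftEw y d) ?fsubsetUr //.
rewrite (@free_liftEw _ d); last first.
  exact/(fsubset_trans (msuppD_le _ _))/fsetSU/msuppZ_le.
rewrite scaler_sumr -big_split /=; apply: eq_bigr => k _.
by rewrite mcoeffD mcoeffZ scalerDl scalerA.
Qed.

HB.instance Definition _ :=
  GRing.isLinear.Build R free_module M *:%R free_lift free_lift_linear.

Lemma free_lift_gen k : free_lift (free_gen k) = h k.
Proof.
rewrite (@free_liftEw _ [fset k]%fset) ?msuppU_le //.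
by rewrite big_seq_fset1 mcoeffUU scale1r.
Qed.
End Lift.
End FreeModule.

(* For [phi : A -> B], an [A]-module [P] and a [B]-module [T], [tensor P T] is
   the [B]-module [P (x)_A T], where [b *: (p (x) t) = p (x) (b *: t)]: the
   quotient of the free [B]-module on [P * T] by the relations below. *)
Section Tensor.
Variables (A B : comNzRingType) (phi : {rmorphism A -> B}).

Section TensorModule.
Variables (P : lmodType A) (T : lmodType B).

Local Notation F := (free_module B (P * T)%type).

Definition tensor_gen (p : P) (t : T) : F := free_gen B (p, t).

Local Notation gen := tensor_gen.

Inductive tensor_rel : F -> Prop :=
| TensorDl p q t : tensor_rel (gen (p + q) t - (gen p t + gen q t))
| TensorDr p t u : tensor_rel (gen p (t + u) - (gen p t + gen p u))
| TensorZl a p t : tensor_rel (gen (a *: p) t - gen p (phi a *: t))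
| TensorZr b p t : tensor_rel (gen p (b *: t) - b *: gen p t).

Definition tensor : lmodType B := quotmod (mod_span tensor_rel).

Definition tens (p : P) (t : T) : tensor := quotmod_pi _ (gen p t).

Lemma tens_rel (z : F) : tensor_rel z -> quotmod_pi (mod_span tensor_rel) z = 0.
Proof.
move=> zR; rewrite -(linear0 (quotmod_pi (mod_span tensor_rel))).
apply/quotmod_piP; rewrite subr0 inE; apply/asboolP => N; exact.
Qed.

Lemma tensDl p q t : tens (p + q) t = tens p t + tens q t.
Proof.
apply/eqP; rewrite /tens -subr_eq0 -linearD -linearB.
by apply/eqP/tens_rel; exact: TensorDl.
Qed.

Lemma tensDr p t u : tens p (t + u) = tens p t + tens p u.
Proof.
apply/eqP; rewrite /tens -subr_eq0 -linearD -linearB.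
by apply/eqP/tens_rel; exact: TensorDr.
Qed.

Lemma tensZl a p t : tens (a *: p) t = tens p (phi a *: t).
Proof.
apply/eqP; rewrite /tens -subr_eq0 -linearB.
by apply/eqP/tens_rel; exact: TensorZl.
Qed.

Lemma tensZr b p t : tens p (b *: t) = b *: tens p t.
Proof.
apply/eqP; rewrite /tens -subr_eq0 -linearZ -linearB.
by apply/eqP/tens_rel; exact: TensorZr.
Qed.
End TensorModule.

Section TensorMap.
Variables (P Q : lmodType A) (f : {linear P -> Q}) (T : lmodType B).

Definition tensor_lift : free_module B (P * T)%type -> tensor Q T :=
  free_lift (fun k => tens (f k.1) k.2).

HB.instance Definition _ := GRing.Linear.on tensor_lift.

Lemma tensor_liftU p t : tensor_lift (tensor_gen p t) = tens (f p) t.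
Proof. exact: free_lift_gen. Qed.

Lemma tensor_lift_rel z : @tensor_rel P T z -> tensor_lift z = 0.
Proof.
have liftB x y : tensor_lift (x - y) = tensor_lift x - tensor_lift y.
  exact: linearB.
have liftD x y : tensor_lift (x + y) = tensor_lift x + tensor_lift y.
  exact: linearD.
case=> [p q t|p t u|a p t|b p t]; rewrite liftB.
- by rewrite liftD !tensor_liftU linearD tensDl subrr.
- by rewrite liftD !tensor_liftU tensDr subrr.
- by rewrite !tensor_liftU linearZ tensZl subrr.
- have liftZ x : tensor_lift (b *: x) = b *: tensor_lift x by exact: linearZ.
  by rewrite liftZ !tensor_liftU tensZr subrr.
Qed.

Lemma tensor_lift_span z :
  z \in mod_span (@tensor_rel P T) -> tensor_lift z = 0.
Proof.
rewrite inE => /asboolP/(_ (kernel tensor_lift)) zK; apply/eqP; apply: zK.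
by move=> y /tensor_lift_rel/eqP.
Qed.

(* [f (x) id_T] *)
Definition tensor_map (x : tensor P T) : tensor Q T :=
  tensor_lift (quotmod_repr x).

Lemma tensor_map_pi z :
  tensor_map (quotmod_pi (mod_span (@tensor_rel P T)) z) = tensor_lift z.
Proof.
apply/eqP; rewrite /tens -subr_eq0 -linearB; apply/eqP/tensor_lift_span.
by apply/quotmod_piP; rewrite quotmod_reprK.
Qed.

Lemma tensor_map_tens p t : tensor_map (tens p t) = tens (f p) t.
Proof. by rewrite tensor_map_pi tensor_liftU. Qed.

Lemma tensor_map_linear : linear tensor_map.
Proof.
move=> a x y; rewrite -[x]quotmod_reprK -[y]quotmod_reprK -linearP.
by rewrite !tensor_map_pi linearP.
Qed.

HB.instance Definition _ :=
  GRing.isLinear.Build B (tensor P T) (tensor Q T) *:%R tensor_map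
    tensor_map_linear.
End TensorMap.

Arguments tensor_map {P Q} f T x.

(* [Tor^A_i(N, T)] with the [B]-module structure coming from [T], computed from
   the projective resolution [P] of the [A]-module [N]. *)
Definition Tor (N : lmodType A) (P : projective_resolution N) (T : lmodType B)
    (i : nat) : lmodType B :=
  if i is j.+1
  then homology (tensor_map (pres_d P j.+1) T) (tensor_map (pres_d P j) T)
  else homology (tensor_map (pres_d P 0) T)
                (\0 : {linear tensor (P 0) T -> tensor (P 0) T}).
End Tensor.

Definition internal_direct_sum (D : choiceType) (M : zmodType)
    (c : D -> zmodClosed M) : Prop :=
  (forall x, exists (s : seq D) (y : D -> M),
     [/\ uniq s, forall i, y i \in c i & x = \sum_(i <- s) y i]) /\
  (forall (s : seq D) (y : D -> M),
     uniq s -> (forall i, y i \in c i) -> \sum_(i <- s) y i = 0 ->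
     forall i, i \in s -> y i = 0).

Record ring_grading (R : comNzRingType) := RingGrading {
  rcomp :> nat -> zmodClosed R;
  rcomp1 : 1 \in rcomp 0;
  rcompM : forall m n x y,
    x \in rcomp m -> y \in rcomp n -> x * y \in rcomp (m + n);
  rcomp_direct : internal_direct_sum rcomp
}.

Record module_grading (R : comNzRingType) (G : ring_grading R)
    (T : lmodType R) := ModuleGrading {
  mcomp :> int -> zmodClosed T;
  mcompZ : forall (m : nat) (n : int) (r : R) (t : T),
    r \in G m -> t \in mcomp n -> r *: t \in mcomp (m%:Z + n);
  mcomp_direct : internal_direct_sum mcomp
}.

Section GradedRing.
Variables (R : comNzRingType) (G : ring_grading R).

Definition base_pred : {pred R} := G 0.

Lemma base_pred_closed : subring_closed base_pred.
Proof.
split; [exact: rcomp1 | exact: rpredB |].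
by move=> x y xG yG; exact: (rcompM xG yG).
Qed.

HB.instance Definition _ :=
  GRing.isSubringClosed.Build R base_pred base_pred_closed.

Record base_ring := BaseRing { base_val : R; _ : base_val \in base_pred }.

HB.instance Definition _ := [isSub for base_val].
HB.instance Definition _ := [Choice of base_ring by <:].
HB.instance Definition _ := [SubChoice_isSubComNzRing of base_ring by <:].

Definition base_incl : {rmorphism base_ring -> R} := val.

(* [R_+], the finite sums of homogeneous elements of positive degree *)
Definition irrelevant : {pred R^o} :=
  [pred x | `[< exists s : seq R,
     (forall y, y \in s -> exists2 n, (0 < n)%N & y \in G n) /\
     x = \sum_(y <- s) y >]].

Lemma irrelevant_closed : submod_closed irrelevant.
Proof.
split=> [|a x y]; rewrite !inE.
  by apply/asboolP; exists [::]; rewrite big_nil.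
move=> /asboolP[s [sG ->]] /asboolP[t [tG ->]]; apply/asboolP.
have [u [z [_ zG ->]]] := (rcomp_direct G).1 a.
exists ([seq z i * x | i <- u, x <- s] ++ t); split=> [v|].
  rewrite mem_cat => /orP[/allpairsP[[i w] /= [_ ws ->]]|/tG//].
  have [n n0 wn] := sG _ ws; exists (i + n)%N; first by rewrite ltn_addl.
  exact: rcompM.
rewrite big_cat /= big_allpairs_dep /=; congr (_ + _).
rewrite /GRing.scale /= mulr_suml; apply: eq_bigr => i _.
by rewrite mulr_sumr.
Qed.

HB.instance Definition _ :=
  GRing.isSubmodClosed.Build R R^o irrelevant irrelevant_closed.
End GradedRing.

(* Main.v *)
Require Import Defs.
From HB Require Import structures.
From mathcomp Require Import all_boot all_algebra boolp classical_sets.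
From mathcomp Require Import monalg.

(** Let [zs] be generators of the extension [b] of [b0] to [R]. The proof takes
place in the class of the modules all of whose [zs]-torsion subquotients are
Artinian. It is a Serre class, and it contains [T]. Indeed let [L] be finitely
generated with [T / L] Artinian. A [zs]-torsion subquotient of [L] is finitely
generated and is torsion for [a] and for [b], hence for [m = m0 + R_+], because
[m0] is the radical of [a0 + b0]. As [m] is maximal, the submodule killed by [m]
is a finite-dimensional vector space; and by Melkersson's criterion
([art_torsion], [art_socle]) a torsion module is Artinian as soon as this
submodule is.

For local cohomology, let [E] be an injective resolution of [T]. The Koszul
cohomology of [zs] with coefficients in [E], computed by iterated cones, is
filtered by subquotients of the cohomology of [E], which is [T]. It thus lies in
the Serre class, and being [zs]-torsion it is Artinian. The cones can now be
traded for torsion functors one at a time. If [x] is one of the generators, it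
acts bijectively on [Gamma_zs E / Gamma_(x, zs) E] by injectivity
([injective_divisible]), so that the cones of [x] on [Gamma_zs E] and on
[Gamma_(x, zs) E] have the same cohomology; the latter contains, up to a
quotient, the elements killed by [x] in the cohomology of [Gamma_(x, zs) E], and
Melkersson's criterion removes the cone ([art_tors_cons]). When no cone is left
the complex is [Gamma_b E].

For Tor, let [P] be a projective resolution of [R0 / b0], by modules of any
size. Since [R0] is Noetherian the identity of [P] is homotopic, degree by
degree, to a map with values in a finitely generated submodule [S]
([homotopic_into_fg]), which makes Tor a subquotient of the image of [S (x) T],
hence a member of the Serre class. Multiplication by an element of [b0] is
homotopic to zero, so that Tor is [zs]-torsion, and Artinian.

Modules are compared as subquotients [Z / B] of ambient modules, through linear
relations; a snake or a long exact sequence then reduces to a relation between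
representatives. *)

Set Implicit Arguments.
Unset Strict Implicit.
Unset Printing Implicit Defensive.

Import GRing.Theory.
Local Open Scope ring_scope.
Local Open Scope classical_set_scope.

(** * Subquotients *)

Section Subquotients.
Variable R : comNzRingType.
Implicit Types M : lmodType R.

Definition submod M (N : set M) : Prop :=
  N 0 /\ forall a x y, N x -> N y -> N (a *: x + y).

Lemma submodZ M (N : set M) a m : submod N -> N m -> N (a *: m).
Proof. by move=> [N0 NP] Nm; rewrite -[_ *: _]addr0; exact: NP. Qed.

Lemma submodD M (N : set M) m n : submod N -> N m -> N n -> N (m + n).
Proof. by move=> [_ NP] Nm; rewrite -[m]scale1r; exact: NP. Qed.

Lemma submodB M (N : set M) m n : submod N -> N m -> N n -> N (m - n).
Proof.
by move=> sN Nm Nn; rewrite -scaleN1r; apply: submodD => //; exact: submodZ.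
Qed.

Lemma submodBK M (N : set M) m n : submod N -> N (m - n) -> N n -> N m.
Proof. by move=> sN Nmn Nn; rewrite -(subrK n m); exact: submodD. Qed.

Lemma submod0 M : submod [set (0 : M)].
Proof. by split=> // a u v -> ->; rewrite scaler0 addr0. Qed.

Lemma submodT M : submod [set: M].
Proof. by []. Qed.

Lemma submodI M (N P : set M) : submod N -> submod P -> submod (N `&` P).
Proof.
move=> [N0 NP] [P0 PP]; split=> // a u v [? ?] [? ?].
by split; [exact: NP|exact: PP].
Qed.

Lemma submod_pack M (N : set M) : submod N ->
  exists N' : submodClosed M, forall m, (m \in N') <-> N m.
Proof.
move=> [N0 NP].
pose p : {pred M} := [pred m | `[< N m >]].
have pc : submod_closed p.
  by split=> [|a u v]; rewrite !inE //; exact: NP.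
pose q := GRing.isSubmodClosed.Build R M p pc.
pose N' : submodClosed M := HB.pack p q.
exists N' => m; have -> : (m \in N') = `[< N m >] by [].
by split=> /asboolP.
Qed.

Lemma submod_mem M (N : submodClosed M) : submod [set m | m \in N].
Proof.
by split=> [|a u v] /=; [exact: rpred0 | move=> *; rewrite rpredD ?rpredZ].
Qed.

Lemma submod_ker M (N : lmodType R) (f : {linear M -> N}) :
  submod [set m | f m = 0].
Proof.
by split=> [|a u v /= u0 v0] /=;
  rewrite ?linear0 // linearP u0 v0 scaler0 addr0.
Qed.

Lemma submod_preim M (N : lmodType R) (f : {linear M -> N}) (S : set N) :
  submod S -> submod [set m | S (f m)].
Proof.
by move=> [S0 SP]; split=> [|a u v Su Sv] /=; rewrite ?linear0 // linearP;
  exact: SP.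
Qed.

Lemma submod_im M (N : lmodType R) (f : {linear M -> N}) :
  submod [set m | exists y, f y = m].
Proof.
split; first by exists 0; rewrite linear0.
by move=> a _ _ [y <-] [w <-]; exists (a *: y + w); rewrite linearP.
Qed.

Lemma chain_mono M (N : nat -> set M) : (forall n, N n.+1 `<=` N n) ->
  forall n m, (n <= m)%N -> N m `<=` N n.
Proof.
move=> dN n m /subnK <-; elim: (m - n)%N => // k IH z.
rewrite addSn => /dN; exact: IH.
Qed.

(** Artinianity of [Z / B], told by chains in the ambient module: quotients are
never formed, and all comparisons take place between submodules. *)
Definition art M (Z B : set M) : Prop :=
  forall N : nat -> set M,
    (forall n, submod (N n)) -> (forall n, B `<=` N n) ->
    (forall n, N n `<=` Z) -> (forall n, N n.+1 `<=` N n) ->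
    exists n, forall m, (n <= m)%N -> N n `<=` N m.

Definition torsq (x : R) M (Z B : set M) : Prop :=
  forall z, Z z -> exists k, B (x ^+ k *: z).

Definition sqclass := forall M, set M -> set M -> Prop.

(** [rho] presents [Z / B] as a quotient of a submodule of [Z' / B'], in
the form of a linear relation. *)
Definition sq_rel M M' (rho : set (M * M')%type) (Z B : set M) (Z' B' :
  set M') :=
  (forall z, Z z -> exists2 z', Z' z' & rho (z, z')) /\
  (forall z z', Z z -> B' z' -> rho (z, z') -> B z).

(** A Serre class of modules, as a class of subquotients: presentations by a
linear relation subsume submodules, quotients and isomorphisms. *)
Record serre (Q : sqclass) : Prop := Serre {
  serre_rel : forall M M' (rho : set (M * M')%type) Z B Z' B',
    submod rho -> submod Z -> submod B -> submod Z' -> submod B' ->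
    B `<=` Z -> B' `<=` Z' -> sq_rel rho Z B Z' B' -> Q M' Z' B' -> Q M Z B;
  serre_ext : forall M (Z Y B : set M),
    submod Z -> submod Y -> submod B -> B `<=` Y -> Y `<=` Z ->
    Q M Y B -> Q M Z Y -> Q M Z B
}.

(** Transport of the submodules between [B] and [Z] to those between [B'] and
[Z']. *)
Definition push M M' (rho : set (M * M')%type) (Z' B' : set M') (N : set M) :
    set M' :=
  [set m' | exists w b z, [/\ Z' w, B' b, N z, rho (z, w) & m' = w + b]].

Section Push.
Variables (M M' : lmodType R) (rho : set (M * M')%type).
Variables (Z B : set M) (Z' B' : set M').
Hypotheses (srho : submod rho) (sZ : submod Z) (sB : submod B).
Hypotheses (sZ' : submod Z') (sB' : submod B') (BZ : B `<=` Z).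
Hypotheses (BZ' : B' `<=` Z') (rhoP : sq_rel rho Z B Z' B').

Lemma push_submod N : submod N -> submod (push rho Z' B' N).
Proof.
move=> sN; split.
  exists 0, 0, 0; rewrite addr0; split=> //; [exact: sZ'.1|exact: sB'.1| |].
    exact: sN.1.
  exact: srho.1.
move=> a _ _ [w [b [z [Zw Bb Nz rz ->]]]] [v [c [y [Zv Bc Ny ry ->]]]].
exists (a *: w + v), (a *: b + c), (a *: z + y); split.
- exact: sZ'.2.
- exact: sB'.2.
- exact: sN.2.
- exact: (srho.2 a _ _ rz ry).
- by rewrite scalerDr addrACA.
Qed.

Lemma push_sup N : submod N -> B' `<=` push rho Z' B' N.
Proof.
move=> sN b Bb; exists 0, b, 0; rewrite add0r; split=> //; [exact: sZ'.1| |].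
  exact: sN.1.
exact: srho.1.
Qed.

Lemma push_sub N : push rho Z' B' N `<=` Z'.
Proof.
by move=> _ [w [b [z [Zw /BZ' Zb _ _ ->]]]]; exact: submodD.
Qed.

Lemma push_mono N P : N `<=` P -> push rho Z' B' N `<=` push rho Z' B' P.
Proof. by move=> NP _ [w [b [z [? ? /NP ? ? ->]]]]; exists w, b, z. Qed.

Lemma push_fwd N z z' : N z -> Z' z' -> rho (z, z') -> push rho Z' B' N z'.
Proof.
by move=> Nz Zz' r; exists z', 0, z; rewrite addr0; split=> //; exact: sB'.1.
Qed.

Lemma push_bwd N z z' : submod N -> B `<=` N -> N `<=` Z ->
  Z z -> rho (z, z') -> push rho Z' B' N z' -> N z.
Proof.
move=> sN BN NZ Zz r [w [b [y [Zw Bb Ny ry e]]]].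
apply: (submodBK sN _ Ny); apply: BN; apply: (rhoP.2 _ b) => //.
  by apply: submodB => //; exact: NZ.
have -> : b = z' - w by rewrite e addrC addKr.
have : rho (-1 *: y + z, -1 *: w + z') := srho.2 (-1) _ _ ry r.
by rewrite !scaleN1r ![- _ + _]addrC.
Qed.
End Push.

Lemma serre_art : serre art.
Proof.
split.
  move=> M M' rho Z B Z' B' srho sZ sB sZ' sB' BZ BZ' rhoP artZ' N sN BN NZ dN.
  have [||||n nP] := artZ' (fun n => push rho Z' B' (N n)).
  - by move=> n; exact: push_submod.
  - by move=> n; exact: push_sup.
  - by move=> n; exact: push_sub.
  - by move=> n; exact: push_mono.
  exists n => m /nP nm y Ny; have [y' Zy' r] := rhoP.1 y (NZ _ _ Ny).
  apply: (push_bwd srho sZ rhoP (sN m) (BN m) (NZ m) (NZ _ _ Ny) r).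
  exact/nm/(push_fwd sB' Ny Zy' r).
move=> M Z Y B sZ sY sB BY YZ artY artZ N sN BN NZ dN.
pose S n : set M := [set m | exists2 y, Y y & N n (m - y)].
have mono := chain_mono dN.
have [||||n1 n1P] := artY (fun n => N n `&` Y).
- by move=> n; exact: submodI.
- by move=> n b Bb; split; [exact: BN|exact: BY].
- by move=> n z [].
- by move=> n z [/dN].
have [||||n2 n2P] := artZ S.
- move=> n; split; first by exists 0; rewrite ?subr0;
    [exact: sY.1|exact: (sN n).1].
  move=> a u v [y Yy Ny] [w Yw Nw]; exists (a *: y + w); first exact: sY.2.
  by rewrite opprD addrACA -scalerBr; exact: (sN n).2.
- by move=> n y Yy; exists y => //; rewrite subrr; exact: (sN n).1.
- move=> n z [y /YZ Zy /NZ Zzy]; exact: submodBK Zzy Zy.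
- by move=> n z [y Yy /dN]; exists y.
exists (maxn n1 n2) => m; rewrite geq_max => /andP[m1 m2] z Nz.
have Nz2 : N n2 z by apply: mono Nz; exact: leq_maxr.
have [|y Yy Nzy] := n2P m m2 z.
  by exists 0; rewrite ?subr0 //; exact: sY.1.
apply: (submodBK (sN m) Nzy).
have [] // := n1P m m1 y; split=> //.
have : N n1 z by apply: mono Nz; exact: leq_maxl.
move: Nzy => /(mono _ _ m1) Nzy /(submodB (sN n1))/(_ Nzy).
by rewrite opprB addrC subrK.
Qed.

Lemma serre_torsq (x : R) : serre (torsq x).
Proof.
split.
  move=> M M' rho Z B Z' B' srho sZ sB sZ' sB' BZ BZ' rhoP tZ' z Zz.
  have [z' Zz' r] := rhoP.1 z Zz; have [k Bk] := tZ' z' Zz'; exists k.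
  apply: rhoP.2 Bk _; first exact: submodZ.
  exact: (submodZ (x ^+ k) srho r).
move=> M Z Y B sZ sY sB BY YZ tY tZ z /tZ[k /tY[l Bl]].
by exists (l + k)%N; rewrite exprD -scalerA.
Qed.

(** A finitely generated module is rarely Artinian, but it may satisfy this
condition. The condition passes to Koszul cohomology, and there it becomes
Artinianity, because Koszul cohomology is torsion. *)
Definition torsion_artinian (zs : seq R) : sqclass := fun M Z B =>
  forall Z1 B1, submod Z1 -> submod B1 -> B `<=` B1 -> B1 `<=` Z1 ->
    Z1 `<=` Z ->
    (forall x, x \in zs -> torsq x Z1 B1) -> art Z1 B1.

Lemma art_torsion_artinian zs M (Z B : set M) : art Z B ->
  torsion_artinian zs Z B.
Proof.
move=> aZ Z1 B1 sZ1 sB1 BB1 BZ1 ZZ1 _ N sN BN NZ dN; apply: aZ => // n.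
  exact: subset_trans (BN n).
exact: subset_trans ZZ1.
Qed.

Lemma serre_torsion_artinian zs : serre (torsion_artinian zs).
Proof.
split.
  move=> M M' rho Z B Z' B' srho sZ sB sZ' sB' BZ BZ' rhoP wZ'.
  move=> Z1 B1 sZ1 sB1 BB1 BZ1 ZZ1 tZ1.
  have sP N : submod N -> submod (push rho Z' B' N) by exact: push_submod.
  have ZZ' : push rho Z' B' Z1 `<=` Z' by exact: push_sub.
  have BB' : push rho Z' B' B1 `<=` push rho Z' B' Z1 by exact: push_mono.
  apply: (serre_rel serre_art srho sZ1 sB1 (sP _ sZ1) (sP _ sB1) BZ1 BB').
    split=> [z Z1z|z z' Z1z Bz' r].
      have [z' Zz' r] := rhoP.1 z (ZZ1 _ Z1z).
      by exists z' => //; exact: push_fwd r.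
    apply: (push_bwd srho sZ rhoP sB1 BB1 _ (ZZ1 _ Z1z) r Bz').
    exact: subset_trans ZZ1.
  apply: wZ' => //; [exact: sP|exact: sP|exact: push_sup|].
  move=> x /tZ1 tx _ [w [b [z [Zw Bb /tx[k Bk] r ->]]]]; exists k.
  rewrite scalerDr; apply: submodD; first exact: sP.
    apply: (push_fwd sB' Bk); first exact: submodZ.
    exact: (submodZ (x ^+ k) srho r).
  by apply: push_sup => //; exact: submodZ.
move=> M Z Y B sZ sY sB BY YZ wY wZ Z1 B1 sZ1 sB1 BB1 BZ1 ZZ1 tZ1.
pose Y1 : set M := [set m | exists y b, [/\ Z1 y, Y y, B1 b & m = y + b]].
have sY1 : submod Y1.
  split; first by exists 0, 0; rewrite addr0; split=> //;
    [exact: sZ1.1|exact: sY.1|exact: sB1.1].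
  move=> a _ _ [y [b [Zy Yy Bb ->]]] [w [c [Zw Yw Bc ->]]].
  exists (a *: y + w), (a *: b + c); split;
    [exact: sZ1.2|exact: sY.2|exact: sB1.2|].
  by rewrite scalerDr addrACA.
have BY1 : B1 `<=` Y1.
  by move=> b Bb; exists 0, b; rewrite add0r; split=> //;
    [exact: sZ1.1|exact: sY.1].
have YZ1 : Y1 `<=` Z1.
  by move=> _ [y [b [Zy _ /BZ1 Zb ->]]]; exact: submodD.
apply: (serre_ext serre_art sZ1 sY1 sB1 BY1 YZ1).
  (* [Y1 / B1 = (Z1 :&: Y) / (B1 :&: Y)] *)
  pose rho : set (M * M)%type := [set p | B1 (p.1 - p.2)].
  have sI N : submod N -> submod (N `&` Y) by move=> ?; exact: submodI.
  apply: (@serre_rel _ serre_art _ _ rho _ _ (Z1 `&` Y) (B1 `&` Y)) => //.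
  - split; first by rewrite /rho /= subrr; exact: sB1.1.
    move=> a [u1 u2] [v1 v2] /= ? ?.
    by rewrite /rho /= opprD addrACA -scalerBr; exact: sB1.2.
  - exact: sI.
  - exact: sI.
  - by move=> b [/BZ1].
  - split=> [_ [y [b [Zy Yy Bb ->]]]|z z' _ [Bz' _] r].
      by exists y => //; rewrite /rho /= addrC addKr.
    exact: submodBK r Bz'.
  apply: wY; [exact: sI|exact: sI| | | |].
  - by move=> b Bb; split; [exact: BB1|exact: BY].
  - by move=> b [/BZ1].
  - by move=> z [].
  - move=> x /tZ1 tx z [/tx[k Bk] Yz]; exists k; split=> //; exact: submodZ.
(* [Z1 / Y1 = (Z1 + Y) / (B1 + Y)] *)
pose ad (N : set M) : set M := [set m | exists y z, [/\ Y y, N z & m = y + z]].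
have sad N : submod N -> submod (ad N).
  move=> sN; split; first by exists 0, 0; rewrite addr0; split=> //;
    [exact: sY.1|exact: sN.1].
  move=> a _ _ [y [b [Yy Nb ->]]] [w [c [Yw Nc ->]]].
  exists (a *: y + w), (a *: b + c); split; [exact: sY.2|exact: sN.2|].
  by rewrite scalerDr addrACA.
have BZad : ad B1 `<=` ad Z1.
  by move=> _ [y [b [? /BZ1 ? ->]]]; exists y, b.
pose rho : set (M * M)%type := [set p | p.1 = p.2].
apply: (@serre_rel _ serre_art _ _ rho _ _ (ad Z1) (ad B1)) => //.
- by split=> // a [u1 u2] [v1 v2] /= ; rewrite /rho /= => -> ->.
- exact: sad.
- exact: sad.
- split=> [z Zz|z z' Zz [y [b [Yy Bb e]]]]; rewrite /rho /=.
    by exists z => //; exists 0, z; rewrite add0r; split=> //; exact: sY.1.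
  move=> ezz'; exists y, b; split=> //; last by rewrite ezz'.
  have -> : y = z - b by rewrite ezz' e addrK.
  by apply: submodB => //; exact: BZ1.
apply: wZ; [exact: sad|exact: sad| | by [] | |].
- by move=> y Yy; exists y, 0; rewrite addr0; split=> //; exact: sB1.1.
- by move=> _ [y [z [/YZ ? /ZZ1 ? ->]]]; exact: submodD.
- move=> x /tZ1 tx _ [y [z [Yy /tx[k Bk] ->]]]; exists k; rewrite scalerDr.
  by exists (x ^+ k *: y), (x ^+ k *: z); split=> //; exact: submodZ.
Qed.

(** Melkersson's criterion for one element. A submodule [N] of the torsion
module [Z / B] is determined by the submodules [x^i (N :&: (B : x^(i+1)))] of
[(B : x) / B], as a power series ideal is by its leading coefficients. They
decrease with [i] and with [N], so that a chain of [N]s gives a doubly indexed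
chain in an Artinian module, which is stationary in both directions. *)
Lemma art_torsion (x : R) M (Z B : set M) : submod Z -> submod B ->
  torsq x Z B -> art [set z | Z z /\ B (x *: z)] B -> art Z B.
Proof.
move=> sZ sB tZ aK N sN BN NZ dN.
have mono := chain_mono dN.
pose K i j : set M :=
  [set w | exists y, [/\ N j y, B (x ^+ i.+1 *: y) & B (w - x ^+ i *: y)]].
have Kmono i i' j j' : (i <= i')%N -> (j <= j')%N -> K i' j' `<=` K i j.
  move=> ii jj w [y [Ny By Bw]]; exists (x ^+ (i' - i) *: y); split.
  - by apply: mono jj _ _; exact: submodZ.
  - by rewrite scalerA -exprD addSn subnKC.
  - by rewrite scalerA -exprD subnKC.
have sK i j : submod (K i j).
  split; first by exists 0; rewrite !scaler0 subr0; split;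
    [exact: (sN j).1|exact: sB.1|exact: sB.1].
  move=> a u v [y [Ny By Bu]] [z [Nz Bz Bv]]; exists (a *: y + z).
  rewrite !scalerDr !scalerA ![_ * a]mulrC -!scalerA opprD addrACA -scalerBr.
  by split; [exact: (sN j).2|exact: sB.2|exact: sB.2].
have BK i j : B `<=` K i j.
  by move=> b Bb; exists 0; rewrite !scaler0 subr0; split=> //;
    [exact: (sN j).1|exact: sB.1].
have KZ i j : K i j `<=` [set z | Z z /\ B (x *: z)].
  move=> w [y [/NZ Zy By Bw]]; split.
    by apply: (submodBK sZ _ (submodZ (x ^+ i) sZ Zy)); exact/(NZ j)/BN.
  apply: (submodBK sB _ By).
  by rewrite exprS -scalerA -scalerBr; exact: submodZ.
have stab (f : nat -> nat * nat) :
    (forall n, ((f n).1 <= (f n.+1).1)%N /\ ((f n).2 <= (f n.+1).2)%N) ->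
    exists n, forall m, (n <= m)%N -> K (f n).1 (f n).2 `<=` K (f m).1 (f m).2.
  move=> fP; apply: (aK (fun n => K (f n).1 (f n).2)) => // n.
  by case: (fP n) => ? ?; exact: Kmono.
have [s sP] := stab (fun n => (n, n)) (fun n => conj (leqnSn n) (leqnSn n)).
have [t tP] : exists t, forall i, (i < s)%N -> forall j, (t <= j)%N ->
  K i t `<=` K i j.
  elim: (s) => [|r [t tP]]; first by exists 0%N.
  have [u uP] := stab (fun n => (r, n)) (fun n => conj (leqnn r) (leqnSn n)).
  exists (maxn t u) => i; rewrite ltnS leq_eqVlt => /orP[/eqP->|ir] j;
    rewrite geq_max => /andP[tj uj].
    by apply: subset_trans (uP j uj); apply: Kmono => //; exact: leq_maxr.
  by apply: subset_trans (tP i ir j tj); apply: Kmono => //; exact: leq_maxl.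
exists (maxn s t) => j; rewrite geq_max => /andP[sj tj].
set T := maxn s t.
have KTj i : K i T `<=` K i j.
  have [si|i_s] := leqP s i.
    apply: (@subset_trans _ (K s s)); first by apply: Kmono => //;
      exact: leq_maxl.
    apply: (subset_trans (sP (maxn i j) _)); first by rewrite leq_max si.
    by apply: Kmono; [exact: leq_maxl|exact: leq_maxr].
  by apply: subset_trans (tP i i_s j tj); apply: Kmono => //; exact: leq_maxr.
have NjT : N j `<=` N T by apply: mono; rewrite geq_max sj.
move=> y NTy; have [k] := tZ y (NZ _ _ NTy).
elim: k y NTy => [|k IH] y NTy Bk; first by apply: BN;
  rewrite expr0 scale1r in Bk.
have [|z [Nz Bz Byz]] := KTj k (x ^+ k *: y).
  by exists y; rewrite subrr; split=> //; exact: sB.1.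
apply: (submodBK (sN j) _ Nz); apply: IH; first by apply: submodB => //;
  exact: NjT.
by rewrite scalerBr.
Qed.

Lemma art_socle (ys : seq R) M (Z B : set M) : submod Z -> submod B ->
  B `<=` Z ->
  (forall y, y \in ys -> torsq y Z B) ->
  art [set z | Z z /\ forall y, y \in ys -> B (y *: z)] B -> art Z B.
Proof.
move=> sZ sB BZ; elim: ys => [_|y ys IH tZ aS].
  suff -> : [set z | Z z /\ forall y : R, y \in [::] -> B (y *: z)] = Z by [].
  by apply/seteqP; split=> z //=; case.
apply: IH => [w wys|]; first by apply: tZ; rewrite inE wys orbT.
set Z' := [set z | _].
have sZ' : submod Z'.
  split; first by split=> [|w _]; rewrite ?scaler0; [exact: sZ.1|exact: sB.1].
  move=> a u v [Zu Bu] [Zv Bv]; split=> [|w wys]; first exact: sZ.2.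
  by rewrite scalerDr scalerA mulrC -scalerA; apply: sB.2;
    [exact: Bu|exact: Bv].
apply: (art_torsion (x := y)) => // [z [Zz _]|].
  by apply: tZ Zz; rewrite mem_head.
suff -> : [set z | Z' z /\ B (y *: z)] =
  [set z | Z z /\ forall w, w \in y :: ys -> B (w *: z)] by [].
apply/seteqP; split=> z /= [].
  move=> [Zz Bz] By; split=> // w; rewrite inE => /orP[/eqP-> //|]; exact: Bz.
move=> Zz Bz; split; last by apply: Bz; rewrite mem_head.
by split=> // w wys; apply: Bz; rewrite inE wys orbT.
Qed.

Lemma torsq_ideal M (Z B : set M) : submod Z -> submod B ->
  submod (M := R^o) [set x | torsq x Z B].
Proof.
move=> sZ sB; split; first by move=> z _; exists 1%N; rewrite scale0r;
  exact: sB.1.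
move=> a x y tx ty z Zz; have [k Bk] := tx z Zz; have [l Bl] := ty z Zz.
exists (k + l)%N; change (B ((a * x + y : R) ^+ (k + l) *: z)).
rewrite exprDn scaler_suml.
elim/big_ind: _ => [|u v|[j /= _] _]; [exact: sB.1|exact: submodD|].
rewrite -mulr_natl; have [lj|jl] := leqP l j.
  by rewrite -(subnK lj) exprD !mulrA -scalerA; exact: submodZ.
have -> : (k + l - j = k + l - j - k + k)%N.
  by rewrite subnK // leq_subRL ?(leq_trans (ltnW jl)) ?leq_addl // addnC
    leq_add2l ltnW.
rewrite exprMn [x ^+ _]exprD -mulrA mulrC -!mulrA.
rewrite [x ^+ k * _]mulrC !mulrA -scalerA; exact: submodZ.
Qed.
End Subquotients.

(** * Finite generation *)

Section FiniteGeneration.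
Variable R : comNzRingType.
Implicit Types M : lmodType R.

Fixpoint gen M (s : seq M) : set M :=
  if s is a :: s' then [set m | exists r w, gen s' w /\ m = r *: a + w]
  else [set 0].

Lemma gen_submod M (s : seq M) : submod (gen s).
Proof.
elim: s => [|a s IH] /=; first exact: submod0.
split; first by exists 0, 0; rewrite scale0r addr0; split=> //; exact: IH.1.
move=> c _ _ [r [w [sw ->]]] [r' [w' [sw' ->]]].
exists (c * r + r'), (c *: w + w'); split; first exact: IH.2.
by rewrite scalerDr scalerDl scalerA addrACA.
Qed.

Lemma gen_mem M (s : seq M) a : a \in s -> gen s a.
Proof.
elim: s => // b s IH; rewrite inE => /orP[/eqP->|/IH sa] /=.
  by exists 1, 0; rewrite scale1r addr0; split=> //; exact: (gen_submod s).1.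
by exists 0, a; rewrite scale0r add0r.
Qed.

Lemma gen_min M (s : seq M) (N : set M) :
  submod N -> (forall a, a \in s -> N a) -> gen s `<=` N.
Proof.
move=> sN; elim: s => [_ _ ->|a s IH sNa _ [r [w [sw ->]]]]; first exact: sN.1.
apply: sN.2; first by apply: sNa; rewrite mem_head.
by apply: IH sw => b bs; apply: sNa; rewrite inE bs orbT.
Qed.

Lemma gen_mono M (s t : seq M) : {subset s <= t} -> gen s `<=` gen t.
Proof. by move=> st; apply: gen_min => [|a /st];
  [exact: gen_submod|exact: gen_mem]. Qed.

Lemma mod_span_gen M (s : seq M) m :
  m \in mod_span [set x | x \in s] <-> gen s m.
Proof.
split=> [|sm].
  rewrite inE => mP; have [N NP] := submod_pack (gen_submod s).
  by apply/NP/mP => y ys; apply/NP/gen_mem.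
rewrite inE => N sN.
exact: (gen_min (submod_mem N)) sm.
Qed.

Definition fg M (N : set M) : Prop := exists s, N = gen s.

Lemma fin_genP M (N : submodClosed M) :
  fin_gen_submod N -> fg [set m | m \in N].
Proof.
move=> [s sP]; exists s; apply/seteqP; split=> m /=; rewrite sP.
  by move/mod_span_gen.
by move=> sm; apply/mod_span_gen.
Qed.

Lemma noetherian_fg (I : set R^o) : noetherian_ring R -> submod I -> fg I.
Proof.
move=> noethR /submod_pack[I' I'P]; have [s sP] := fin_genP (noethR I').
by exists s; rewrite -sP; apply/seteqP; split=> r /= /I'P.
Qed.

(** By induction on the generators, as in Hilbert's basis theorem: the
coefficients of the first generator in the elements of [N] form an ideal. *)
Lemma fg_sub M (s : seq M) (N : set M) :
  noetherian_ring R -> submod N -> N `<=` gen s -> fg N.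
Proof.
move=> noethR; elim: s N => [|a s IH] N sN Ns.
  by exists [::]; apply/seteqP; split=> // _ ->; exact: sN.1.
pose I : set R^o := [set r | exists w, gen s w /\ N (r *: a + w)].
have [|rs IE] := @noetherian_fg I noethR.
  split; first by exists 0; rewrite scale0r addr0; split;
    [exact: (gen_submod s).1|exact: sN.1].
  move=> c r r' [w [sw Nw]] [w' [sw' Nw']]; exists (c *: w + w').
  split; first exact: (gen_submod s).2.
  by rewrite scalerDl -scalerA addrACA -scalerDr; exact: sN.2.
have [ns [nsN nsP]] : exists ns : seq M, (forall n, n \in ns -> N n) /\
    forall r, r \in rs -> exists w, gen s w /\ gen ns (r *: a + w).
  have : forall r, r \in rs -> I r by move=> r /gen_mem; rewrite IE.
  elim: (rs) => [|r rs' IHr] rsI; first by exists [::].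
  have [|ns [nsN nsP]] := IHr; first by move=> r' rr'; apply: rsI;
    rewrite inE rr' orbT.
  have [w [sw Nw]] := rsI r (mem_head _ _).
  exists (r *: a + w :: ns); split=> n; rewrite inE => /orP[/eqP->//|].
  - exact: nsN.
  - by exists w; split=> //; apply: gen_mem; rewrite mem_head.
  - move=> /nsP[w' [sw' nw']]; exists w'; split=> //.
    by apply: gen_mono nw' => z zs; rewrite inE zs orbT.
have IP r : I r -> exists w, gen s w /\ gen ns (r *: a + w).
  rewrite IE; apply: (@gen_min R^o rs [set r | exists w, gen s w /\ gen ns (r *:
    a + w)] _ nsP).
  split; first by exists 0; rewrite scale0r addr0; split;
    [exact: (gen_submod s).1|exact: (gen_submod ns).1].
  move=> c r1 r' [w [sw Nw]] [w' [sw' Nw']]; exists (c *: w + w').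
  split; first exact: (gen_submod s).2.
  by rewrite scalerDl -scalerA addrACA -scalerDr; exact: (gen_submod ns).2.
have [||t tE] := IH (N `&` gen s);
  [exact: submodI (gen_submod s)|by move=> m []|].
exists (ns ++ t); apply/seteqP; split=> [n Nn|]; last first.
  apply: gen_min => // m; rewrite mem_cat => /orP[/nsN//|/gen_mem].
  by rewrite -tE => -[].
have [r [w [sw e]]] := Ns _ Nn.
have [|w' [sw' nw']] := IP r; first by exists w; rewrite -e.
apply: (submodBK (gen_submod _) (n := r *: a + w')); last first.
  by apply: gen_mono nw' => m ms; rewrite mem_cat ms.
apply: (@gen_mono _ t); first by move=> m ms; rewrite mem_cat ms orbT.
rewrite -tE; split.
  by apply: submodB => //; apply: (gen_min sN nsN).
by rewrite e opprD addrACA subrr add0r; apply: submodB => //; exact: gen_submod.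
Qed.

Definition addgen M (B : set M) (s : seq M) : set M :=
  [set m | exists b g, [/\ B b, gen s g & m = b + g]].

Lemma addgen_submod M (B : set M) s : submod B -> submod (addgen B s).
Proof.
move=> sB; split; first by exists 0, 0; rewrite addr0; split=> //;
  [exact: sB.1|exact: (gen_submod s).1].
move=> a _ _ [b [g [Bb sg ->]]] [c [h [Bc sh ->]]].
exists (a *: b + c), (a *: g + h); rewrite scalerDr addrACA.
by split=> //; [exact: sB.2|exact: (gen_submod s).2].
Qed.

(** [B + (s) / B] has finite length when the ideal [m], which is maximal by the
first hypothesis, annihilates it: adding one generator adds at most a simple
module. *)
Lemma art_fin_length (m : set R) M (B : set M) s :
  (forall r, m r \/ exists r', m (r' * r - 1)) -> submod B ->
  (forall r a, m r -> a \in s -> B (r *: a)) -> art (addgen B s) B.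
Proof.
move=> mmax sB; elim: s => [|a s IH] mB.
  move=> N sN BN NZ dN; exists 0%N => n _ z /NZ[b [_ [Bb -> ->]]].
  by rewrite addr0; exact: BN.
have sY := addgen_submod s sB; have sZ := addgen_submod (a :: s) sB.
apply: (serre_ext (@serre_art R) sZ sY sB).
- by move=> b Bb; exists b, 0; rewrite addr0; split=> //;
    exact: (gen_submod s).1.
- move=> _ [b [g [Bb sg ->]]]; exists b, g; split=> //=.
  by exists 0, g; rewrite scale0r add0r.
- by apply: IH => r x mr xs; apply: mB; rewrite ?inE ?xs ?orbT.
move=> N sN YN NZ dN.
have NB n b : B b -> N n b.
  by move=> Bb; apply: YN; exists b, 0; rewrite addr0; split=> //;
    exact: (gen_submod s).1.
have Ngen n g : gen s g -> N n g.
  by move=> sg; apply: YN; exists 0, g; rewrite add0r; split=> //; exact: sB.1.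
have [allN|/existsNP[n nN]] := pselect (forall n, N n a).
  exists 0%N => n _ z /NZ[b [_ [Bb [r [w [sw ->]]] ->]]].
  apply: submodD => //; first exact: NB.
  by apply: (sN n).2 => //; exact: Ngen.
exists n => k _ z Nz; apply: YN.
have [b [_ [Bb [r [w [sw ->]]] e]]] := NZ _ _ Nz.
rewrite {}e in Nz *.
have Nra : N n (r *: a).
  have := submodB (sN n) (submodB (sN n) Nz (NB n b Bb)) (Ngen n w sw).
  by rewrite [b + _]addrC !addrK.
have [mr|[r' mr']] := mmax r.
  exists (b + r *: a), w; rewrite addrA; split=> //; apply: submodD => //.
  by apply: mB => //; rewrite mem_head.
case: nN; have : B ((r' * r - 1) *: a) by apply: mB => //; rewrite mem_head.
move=> /(NB n) /(submodB (sN n) (submodZ r' (sN n) Nra)).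
by rewrite scalerBl scale1r scalerA opprB addrC subrK.
Qed.

(** Let [L] be finitely generated with [T / L] Artinian. The [zs]-torsion
subquotients of [L] are torsion for the maximal ideal [(ys)], and the part of
them killed by this ideal has finite length. *)
Lemma minimax_torsion_artinian (zs ys : seq R) (T : lmodType R) :
  noetherian_ring R ->
  (forall r, gen (M := R^o) ys r \/ exists r', gen (M :=
    R^o) ys (r' * r - 1)) ->
  (forall Z B : set T, submod Z -> submod B ->
     (forall x, x \in zs -> torsq x Z B) -> forall y, y \in ys ->
       torsq y Z B) ->
  minimax_module T -> torsion_artinian zs [set: T] [set 0].
Proof.
move=> noethR ysmax ystors [L [/fin_genP[s Ls] artTL]].
have sL := submod_mem L.
apply: (serre_ext (@serre_torsion_artinian R zs) _ sL (submod0 T)) => //.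
- by move=> _ ->; exact: sL.1.
- move=> Z B sZ sB BZ0 BZ ZL tZ.
  apply: (@art_socle _ ys) => //; first exact: (ystors _ _ sZ sB tZ).
  set S := [set z | _].
  have sS : submod S.
    split; first by split=> [|w _]; rewrite ?scaler0; [exact: sZ.1|exact: sB.1].
    move=> a u v [Zu Bu] [Zv Bv]; split=> [|w wys]; first exact: sZ.2.
    by rewrite scalerDr scalerA mulrC -scalerA; apply: sB.2;
      [exact: Bu|exact: Bv].
  have [|t St] := fg_sub noethR sS (s := s); first by move=> z [/ZL];
    rewrite Ls.
  have -> : S = addgen B t.
    apply/seteqP; split=> [z Sz|_ [b [g [Bb tg ->]]]].
      by exists 0, z; rewrite add0r -St; split=> //; exact: sB.1.
    apply: submodD => //; last by rewrite St.
    by split=> [|y yys]; [exact: BZ|exact: submodZ].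
  apply: (art_fin_length ysmax) => // r a ysr /gen_mem; rewrite -St => -[_ Ba].
  apply: (@gen_min R^o ys [set r | B (r *: a)]) ysr => //.
  split=> [|c u v Bu Bv] /=; first by rewrite scale0r; exact: sB.1.
  by rewrite scalerDl -scalerA; exact: sB.2.
apply: art_torsion_artinian => N sN LN _ dN.
have /boolp.choice[N' N'P] n : exists N' : submodClosed (quotmod L), forall z,
    quotmod_pi L z \in N' <-> N n z.
  have [|N' N'P] := @submod_pack _ (quotmod L) [set q | N n (quotmod_repr q)].
    have reprP z : N n (z - quotmod_repr (quotmod_pi L z)).
      by apply: LN; apply/quotmod_piP; rewrite quotmod_reprK.
    split=> [|a u v Nu Nv] /=.
      have := reprP 0; rewrite linear0 => /(submodB (sN n) (sN n).1).
      by rewrite sub0r opprB subr0.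
    have := submodB (sN n) ((sN n).2 a _ _ Nu Nv)
      (reprP (a *: quotmod_repr u + quotmod_repr v)).
    by rewrite subKr linearP /= !quotmod_reprK.
  exists N' => z; rewrite N'P /=.
  have Lz : N n (z - quotmod_repr (quotmod_pi L z)).
    by apply: LN; apply/quotmod_piP; rewrite quotmod_reprK.
  split=> Nz; first exact: submodBK Lz Nz.
  by have := submodB (sN n) Nz Lz; rewrite subKr.
have [|n nP] := artTL N'.
  by move=> n q; rewrite -[q]quotmod_reprK => /N'P/dN Nq; apply/N'P.
by exists n => m /nP nm z /N'P; rewrite -nm => /N'P.
Qed.
End FiniteGeneration.

(** * Torsion and Koszul cones *)

Section Cones.
Variable R : comNzRingType.
Implicit Types (M N E : lmodType R) (zs : seq R).

Definition tors zs M : set M :=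
  [set m | forall x, x \in zs -> exists k, x ^+ k *: m = 0].

Lemma expZ0 (x : R) k l M (m : M) : x ^+ k *: m = 0 -> x ^+ (l + k) *: m = 0.
Proof. by move=> km; rewrite exprD -scalerA km scaler0. Qed.

Lemma tors_submod zs M : submod (@tors zs M).
Proof.
split=> [x _|a u v tu tv x xs]; first by exists 0%N; rewrite scaler0.
have [k ku] := tu x xs; have [l lv] := tv x xs; exists (k + l)%N.
rewrite scalerDr (expZ0 k lv) addr0 scalerA mulrC -scalerA addnC.
by rewrite (expZ0 l ku) scaler0.
Qed.

Lemma tors_lin zs M N (f : {linear M -> N}) m : tors zs m -> tors zs (f m).
Proof.
by move=> tm x /tm[k km]; exists k; rewrite -linearZ km linear0.
Qed.

Lemma tors_cons x zs M (m : M) :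
  tors (x :: zs) m <-> (exists k, x ^+ k *: m = 0) /\ tors zs m.
Proof.
split=> [tm|[kx tm] y]; last by rewrite inE => /orP[/eqP->//|]; exact: tm.
split; first by apply: tm; rewrite mem_head.
by move=> y yz; apply: tm; rewrite inE yz orbT.
Qed.

Lemma tors_pair zs M N (u : M) (v : N) :
  tors zs (u, v) <-> tors zs u /\ tors zs v.
Proof.
split=> [tuv|[tu tv] x xs].
  by split=> x /tuv[k kuv]; exists k; case: kuv.
have [k ku] := tu x xs; have [l lv] := tv x xs; exists (k + l)%N.
have -> : x ^+ (k + l) *: (u, v) = (x ^+ (k + l) *: u, x ^+ (k + l) *: v) by [].
by rewrite (expZ0 k lv) addnC (expZ0 l ku).
Qed.

(** What is retained of injectivity. It says that [x] is surjective on
[Gamma_zs M] modulo [x]-torsion, hence bijective there. The quantification over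
[zs] makes it pass from [M] to its torsion submodules, so that these need not be
shown to be injective. *)
Definition divisible_mod_torsion M : Prop :=
  forall zs x (e : M), tors zs e ->
    exists f n, tors zs f /\ x ^+ n *: (e - x *: f) = 0.

Lemma noetherian_ann M x (e : M) : noetherian_ring R ->
  exists n, forall r, r *: (x ^+ n.+1 *: e) = 0 -> r *: (x ^+ n *: e) = 0.
Proof.
move=> noethR; pose I : set R^o := [set r | exists n, r *: (x ^+ n *: e) = 0].
have up k l r : r *: (x ^+ k *: e) = 0 -> r *: (x ^+ (l + k) *: e) = 0.
  by move=> rk; rewrite exprD -scalerA scalerA mulrC -scalerA rk scaler0.
have [|s Is] := @noetherian_fg R I noethR.
  split; first by exists 0%N; rewrite scale0r.
  move=> c r r' [k rk] [l rl]; exists (k + l)%N.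
  rewrite scalerDl (up _ _ _ rl) addr0 addnC.
  by have := up _ l _ rk; rewrite -[(c *: r) *: _]scalerA => ->;
    rewrite scaler0.
have [n nP] : exists n, forall r, r \in s -> r *: (x ^+ n *: e) = 0.
  have : forall r, r \in s -> I r by move=> r /gen_mem; rewrite Is.
  elim: (s) => [|a t IH] sI; first by exists 0%N.
  have [|n nP] := IH; first by move=> r rt; apply: sI; rewrite inE rt orbT.
  have [k ak] := sI a (mem_head _ _).
  exists (n + k)%N => r; rewrite inE => /orP[/eqP->|/nP rn]; first exact: up.
  by rewrite addnC; exact: up.
exists n => r rn; have : I r by exists n.+1.
rewrite Is; apply: (@gen_min R R^o s [set r | r *: (x ^+ n *: e) = 0]) => //.
split=> [|c u v u0 v0] /=; first by rewrite scale0r.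
by rewrite scalerDl v0 addr0 -[(c *: u) *: _]scalerA u0 scaler0.
Qed.

(** By noetherianity multiplication by [x] is injective on [R (x^n e)] for
some [n]. Extending the inclusion of this module along it gives an endomorphism
[h] of [E] with [h (x m) = m] for [m] in [R (x^n e)], and [f = h e] is killed by
whatever kills [e]. *)
Lemma injective_divisible E : noetherian_ring R ->
  injective_module E -> divisible_mod_torsion E.
Proof.
move=> noethR injE zs x e te; have [n nP] := noetherian_ann x e noethR.
have [|N NP] := @submod_pack _ E [set m | exists r, m = r *: (x ^+ n *: e)].
  split; first by exists 0; rewrite scale0r.
  by move=> a _ _ [r ->] [r' ->]; exists (a * r + r'); rewrite scalerDl scalerA.
have [|h hP] := injE (submodule N) E ( *:%R x \o \val) \val.
  move=> u v /= uv; apply: val_inj; apply/eqP; rewrite -subr_eq0 /=; apply/eqP.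
  have : submod_val u - submod_val v \in N :=
    submodB (submod_mem N) (valP u) (valP v).
  move=> /NP[r e1]; rewrite e1; apply: nP.
  by rewrite exprS -scalerA scalerA mulrC -scalerA -e1 scalerBr; apply/eqP;
    rewrite subr_eq0; apply/eqP.
exists (h e), n; split; first exact: tors_lin.
have Nn : x ^+ n *: e \in submod_pred N by apply/NP; exists 1; rewrite scale1r.
have /= := hP (Submod Nn); rewrite scalerA -exprS linearZ /=.
by rewrite scalerBr scalerA -exprSr => ->; rewrite subrr.
Qed.

Lemma divisible_pair M N : divisible_mod_torsion M ->
  divisible_mod_torsion N -> divisible_mod_torsion (M * N)%type.
Proof.
move=> gM gN zs x [u v] /tors_pair[tu tv].
have [f [k [tf kf]]] := gM zs x u tu; have [g [l [tg lg]]] := gN zs x v tv.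
exists (f, g), (k + l)%N; split; first exact/tors_pair.
have -> : x ^+ (k + l) *: ((u, v) - x *: (f, g)) =
  (x ^+ (k + l) *: (u - x *: f), x ^+ (k + l) *: (v - x *: g)) by [].
by rewrite (expZ0 k lg) addnC (expZ0 l kf).
Qed.

Record cochain := Cochain {
  cobj :> nat -> lmodType R;
  cd : forall i, {linear cobj i -> cobj i.+1};
  cdd : forall i m, cd i.+1 (cd i m) = 0
}.

(** The term before the [i]th one and the differential out of it, so that degree
zero needs no separate treatment. *)
Definition prev (C : cochain) i : lmodType R :=
  if i is j.+1 then C j else 'rV[R]_0.

Definition pd (C : cochain) i : {linear prev C i -> C i} :=
  match i return {linear prev C i -> C i} with
  | 0 => (\0 : {linear 'rV[R]_0 -> C 0})
  | j.+1 => cd C j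
  end.

Lemma cd_pd (C : cochain) i m : cd C i (pd C i m) = 0.
Proof. by case: i m => [|i] m /=; [rewrite linear0|exact: cdd]. Qed.

(** Cocycles and coboundaries of [Gamma_zs C]. *)
Definition cocyc zs (C : cochain) i : set (C i) :=
  [set z | tors zs z /\ cd C i z = 0].

Definition cobnd zs (C : cochain) i : set (C i) :=
  [set z | exists2 y, tors zs y & pd C i y = z].

Arguments cocyc : clear implicits.
Arguments cobnd : clear implicits.

Lemma cocyc_submod zs C i : submod (cocyc zs C i).
Proof.
apply: submodI; first exact: tors_submod.
by split=> [|a u v /= u0 v0]; rewrite ?linear0 // linearP u0 v0 scaler0 addr0.
Qed.

Lemma cobnd_submod zs C i : submod (cobnd zs C i).
Proof.
split; first by exists 0; rewrite ?linear0 //; exact: (tors_submod _ _).1.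
move=> a _ _ [y ty <-] [w tw <-]; exists (a *: y + w).
  exact: (tors_submod _ _).2.
by rewrite linearP.
Qed.

Lemma cobnd_cocyc zs C i : cobnd zs C i `<=` cocyc zs C i.
Proof. by move=> _ [y ty <-]; split; [exact: tors_lin|exact: cd_pd]. Qed.

Section Cone.
Variables (x : R) (C : cochain).

Definition cone_obj i : lmodType R := (C i * prev C i)%type.

Definition cone_fun i (m : cone_obj i) : cone_obj i.+1 :=
  (cd C i m.1, x *: m.1 - pd C i m.2).

Lemma cone_fun_linear i : linear (@cone_fun i).
Proof.
move=> a u v; apply/pair_equal_spec; split; first by rewrite /= linearP.
rewrite /= [pd C i _]linearP scalerDr opprD addrACA scalerA mulrC -scalerA.
by rewrite -scalerBr.
Qed.

HB.instance Definition _ i :=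
  GRing.isLinear.Build R (cone_obj i) (cone_obj i.+1) *:%R (@cone_fun i)
    (@cone_fun_linear i).

Lemma cone_dd i m : cone_fun (@cone_fun i m) = 0.
Proof.
case: m => u v; rewrite /cone_fun /= cdd; congr (_, _).
by rewrite linearB linearZ /= cd_pd subr0 subrr.
Qed.

(** The shifted mapping cone of [x] on [C]. *)
Definition cone : cochain :=
  @Cochain cone_obj (fun i => @cone_fun i) cone_dd.
End Cone.

(** The kernel and the cokernel of [x] on the cohomology of [C] filter that
of the cone. *)
Lemma serre_cone (Q : sqclass R) x C : serre Q ->
  (forall i, Q _ (cocyc [::] C i) (cobnd [::] C i)) ->
  forall i, Q _ (cocyc [::] (cone x C) i) (cobnd [::] (cone x C) i).
Proof.
move=> sQ QC i; have tnil M (m : M) : tors [::] m by [].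
set Z := cocyc _ (cone x C) i; set B := cobnd _ (cone x C) i.
have sZ : submod Z by exact: cocyc_submod.
have sB : submod B by exact: cobnd_submod.
have BZ : B `<=` Z by exact: cobnd_cocyc.
pose Y : set (cone x C i) := Z `&` [set m | cobnd [::] C i m.1].
have sY : submod Y.
  apply: submodI => //; have [B0 BP] := cobnd_submod [::] C i.
  by split=> // a u v; exact: BP.
have BY : B `<=` Y.
  move=> m Bm; split; first exact: BZ.
  case: Bm => y _ <-; case: i {QC Z B sZ sB BZ Y sY m} y => [|i] y;
    last by case: y => a b; exists a.
  by exists 0; rewrite ?linear0.
apply: (serre_ext sQ sZ sY sB BY) => [m []//||]; last first.
  pose rho : set (cone x C i * C i)%type := [set p | p.1.1 = p.2].
  apply: (serre_rel sQ (rho := rho) _ sZ sY (cocyc_submod [::] C i)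
    (cobnd_submod [::] C i)) => //.
  - by split=> // a [u w] [v y]; rewrite /rho /= => <- <-.
  - by move=> m [].
  - exact: cobnd_cocyc.
  split=> [m [_ /= [dm _]]|m m' Zm Bm' r]; first by exists m.1.
  by split=> //=; rewrite r.
case: i @Z @B sZ sB BZ @Y sY BY => [|i] Z B sZ sB BZ Y sY BY.
  apply: (serre_rel sQ (rho := [set p | p.1 = 0 /\ p.2 = 0]) _ sY sB
    (cocyc_submod [::] C 0) (cobnd_submod [::] C 0) BY) (QC 0).
  - split=> // a u v [u0 u0'] [v0 v0']; split; rewrite /= -[in RHS](addr0 0).
      by rewrite u0 v0 scaler0.
    by rewrite u0' v0' scaler0.
  - exact: cobnd_cocyc.
  split=> [m [_ /= [y _ ym]]|m m' _ _ /= [-> _]]; last exact: sB.1.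
  exists 0; first exact: (cocyc_submod _ _ _).1.
  split=> //; case: m ym => u v /= <-; rewrite [v]thinmx0 //.
pose rho : set (cone x C i.+1 * C i)%type :=
  [set p | exists2 a, p.1.1 = cd C i a & p.2 = p.1.2 - x *: a].
apply: (serre_rel sQ (rho := rho) _ sY sB (cocyc_submod [::] C i)
    (cobnd_submod [::] C i) BY) (QC i).
- split; first by exists 0; rewrite /= ?linear0 ?subr0 ?addr0.
  move=> c [[u v] w] [[u' v'] w'] [a /= -> ->] [a' /= -> ->];
    exists (c *: a + a').
    by rewrite linearP.
  rewrite /= scalerBr !scalerDr !scalerA [c * x]mulrC opprD addrACA //.
- exact: cobnd_cocyc.
split=> [[u v] [[_ [_ /= uv]] [a _ /= au]]|[u v] w _ [b _ bw] [a /= au aw]].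
  exists (v - x *: a); last by exists a.
  split=> //; rewrite linearB linearZ /= au; apply/eqP.
  by rewrite -oppr_eq0 opprB uv.
exists (a, - b) => //=; rewrite /cone_fun /= -au; congr (_, _).
by rewrite linearN opprK bw aw addrC subrK.
Qed.

Lemma cone_torsion x C i :
  torsq x (cocyc [::] (cone x C) i) (cobnd [::] (cone x C) i).
Proof.
move=> [u v] [_ [/= du uv]]; exists 1%N; rewrite expr1.
have {}uv : x *: u = pd C i v by apply/eqP; rewrite -subr_eq0 uv.
case: i u v du uv => [|i] u v du uv.
  by exists 0 => //; apply/esym/pair_equal_spec; split;
    [exact: uv|exact: thinmx0].
exists (v, 0) => //; rewrite /= /cone_fun /= linear0 subr0.
by rewrite -uv.
Qed.

(** Since [x] is bijective on [Gamma_zs C / Gamma_(x, zs) C], its cones on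
[Gamma_zs C] and on [Gamma_(x, zs) C] have the same cohomology. The elements
killed by [x] in the cohomology of [Gamma_(x, zs) C] form a quotient of it, and
they control this cohomology, which is [x]-torsion. *)
Lemma art_tors_cons x zs (C : cochain) :
  (forall i, divisible_mod_torsion (C i)) ->
  (forall i, art (cocyc zs (cone x C) i) (cobnd zs (cone x C) i)) ->
  forall i, art (cocyc (x :: zs) C i) (cobnd (x :: zs) C i).
Proof.
move=> divC artc i.
set Z := cocyc _ _ _; set B := cobnd _ _ _.
have sZ : submod Z by exact: cocyc_submod.
have sB : submod B by exact: cobnd_submod.
have BZ : B `<=` Z by exact: cobnd_cocyc.
apply: (art_torsion (x := x)) => //.
  move=> z [/tors_cons[[k kz] _] _]; exists k; rewrite kz; exact: sB.1.
pose rho : set (C i * cone x C i)%type :=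
  [set p | [/\ p.1 = p.2.1, tors (x :: zs) p.2.2 & x *: p.1 = pd C i p.2.2]].
apply: (serre_rel (@serre_art R) (rho :=
  rho) _ _ sB (cocyc_submod zs (cone x C) i)
    (cobnd_submod zs (cone x C) i)) (artc i).
- split; first by split=> //=; rewrite ?scaler0 ?linear0 //;
    exact: (tors_submod _ _).1.
  move=> a [u [u' v]] [w [w' y]] [/= -> tv uv] [/= -> ty wy]; split=> //=.
    exact: (tors_submod _ _).2.
  by rewrite scalerDr linearP -uv -wy !scalerA mulrC.
- split=> [|a u v [Zu Bu] [Zv Bv]]; first by rewrite /= scaler0; split;
    [exact: sZ.1|exact: sB.1].
  split; first exact: sZ.2.
  by rewrite scalerDr scalerA mulrC -scalerA; exact: sB.2.
- by move=> b Bb; split; [exact: BZ|exact: submodZ].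
- exact: cobnd_cocyc.
split=> [z [[tz dz] [v tv vz]]|z [u v] [[tz _] _] [ab tab abE] [/= zu tv zv]].
  exists (z, v); last by split.
  split; last by rewrite /= /cone_fun /= dz vz subrr.
  by apply/tors_pair; split; [case/tors_cons: tz|case/tors_cons: tv].
case: i @Z @B sZ sB BZ z u v @rho tz zu tv zv ab tab abE => [|i] Z B sZ sB BZ z
  u v rho tz zu tv zv ab tab abE.
  by rewrite /= in abE; case: abE zu => <- _ ->; exact: sB.1.
case: ab tab abE => a b /tors_pair[ta tb]; rewrite /= /cone_fun /= => -[au bv].
have [c [tc [t [tt bE]]]] : exists c, tors zs c /\
    exists t, tors (x :: zs) t /\ b = x *: c + t.
  have [c [n [tc nc]]] : exists f n, tors zs f /\ x ^+ n *: (b - x *: f) = 0.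
    case: i {Z B sZ sB BZ rho zu tv zv ta au bv tz z u v a} b tb => [|i] b tb;
      last exact: divC.
    by exists 0, 0%N; split; [exact: (tors_submod _ _).1|rewrite ![_ - _]thinmx0
      scaler0].
  exists c; split=> //; exists (b - x *: c); rewrite addrCA subrr addr0;
    split=> //.
  apply/tors_cons; split; first by exists n.
  by apply: submodB (tors_submod _ _) tb _; exact: submodZ (tors_submod _ _) tc.
exists (a - pd C i c); last by rewrite linearB /= cd_pd subr0 au zu.
apply/tors_cons; split; last first.
  by apply: submodB (tors_submod _ _) ta _; exact: tors_lin.
have : tors (x :: zs) (x *: (a - pd C i c)).
  have -> : x *: (a - pd C i c) = v + pd C i t.
    have pb : pd C i b = x *: pd C i c + pd C i t by rewrite bE linearD linearZ.
    by rewrite scalerBr -bv pb opprD addrA subrK.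
  by apply: submodD (tors_submod _ _) tv _; exact: tors_lin.
by move=> /tors_cons[[k kx] _]; exists k.+1; rewrite exprSr -scalerA.
Qed.

Fixpoint koszul xs (C : cochain) : cochain :=
  if xs is x :: xs' then cone x (koszul xs' C) else C.

Lemma koszul_divisible xs (C : cochain) :
  (forall i, divisible_mod_torsion (C i)) ->
  forall i, divisible_mod_torsion (koszul xs C i).
Proof.
move=> divC; elim: xs => //= x xs IH i; apply: divisible_pair => //.
case: i => [|i] //= zs y e _; exists 0, 0%N.
by split; [exact: (tors_submod _ _).1|rewrite [_ - _]thinmx0 scaler0].
Qed.

Lemma serre_koszul (Q : sqclass R) xs C : serre Q ->
  (forall i, Q _ (cocyc [::] C i) (cobnd [::] C i)) ->
  forall i, Q _ (cocyc [::] (koszul xs C) i) (cobnd [::] (koszul xs C) i).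
Proof. by move=> sQ QC; elim: xs => //= x xs IH; exact: serre_cone. Qed.

Lemma koszul_torsion xs C x : x \in xs -> forall i,
  torsq x (cocyc [::] (koszul xs C) i) (cobnd [::] (koszul xs C) i).
Proof.
elim: xs => //= y xs IH; rewrite inE => /orP[/eqP<-|/IH tx] i.
  exact: cone_torsion.
exact: serre_cone (serre_torsq x) tx i.
Qed.

Lemma art_tors_koszul xs zs (C : cochain) :
  (forall i, divisible_mod_torsion (C i)) ->
  (forall i, art (cocyc zs (koszul xs C) i) (cobnd zs (koszul xs C) i)) ->
  forall i, art (cocyc (rev xs ++ zs) C i) (cobnd (rev xs ++ zs) C i).
Proof.
move=> divC; elim: xs zs => //= x xs IH zs artc i.
rewrite rev_cons cat_rcons; apply: IH.
by apply: art_tors_cons => //; exact: koszul_divisible.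
Qed.

(** Koszul cohomology lies in the Serre class of the cohomology and is torsion,
hence Artinian; removing the cones one at a time introduces the torsion
functor. *)
Lemma art_cohomology zs (C : cochain) :
  (forall i, divisible_mod_torsion (C i)) ->
  (forall i, torsion_artinian zs (cocyc [::] C i) (cobnd [::] C i)) ->
  forall i, art (cocyc zs C i) (cobnd zs C i).
Proof.
move=> divC wC i.
suff : art (cocyc (rev (rev zs) ++ [::]) C i) (cobnd (rev (rev zs) ++ [::]) C
  i).
  by rewrite cats0 revK.
apply: art_tors_koszul => // j;
  apply: (serre_koszul (rev zs) (serre_torsion_artinian zs) wC) => //.
- exact: cocyc_submod.
- exact: cobnd_submod.
- exact: cobnd_cocyc.
- by move=> x xzs; apply: koszul_torsion; rewrite mem_rev.
Qed.
End Cones.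

(** * Local cohomology *)

Arguments cocyc : clear implicits.
Arguments cobnd : clear implicits.

Section LocalCohomology.
Variable R : comNzRingType.
Implicit Types (M N T : lmodType R) (zs : seq R) (I : ideal R).

Lemma art_artinian M : art [set: M] [set 0] -> artinian_module M.
Proof.
move=> artM N dN.
have [||||n nP] := artM (fun n => [set m | m \in N n]).
- by move=> n; exact: submod_mem.
- by move=> n _ ->; exact: rpred0.
- by [].
- by move=> n z /= /dN.
exists n => m nm z; apply/idP/idP; last exact: nP.
exact: (@chain_mono _ _ (fun k => [set x | x \in N k]) dN n m nm z).
Qed.

Lemma artinian_homology (L M N : lmodType R) (f : {linear L -> M})
    (g : {linear M -> N}) : (forall y, g (f y) = 0) ->
  art [set m | g m = 0] [set m | exists y, f y = m] ->
  artinian_module (homology f g).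
Proof.
move=> gf artM; apply: art_artinian.
pose rho : set (homology f g * M)%type :=
  [set p | exists2 k, p.1 = quotmod_pi (@im_in_kernel R L M N f g) k & p.2 =
    submod_val k].
apply: (serre_rel (@serre_art R) (rho := rho)) artM => //.
- split; first by exists 0; rewrite ?linear0.
  move=> a [q m] [q' m'] [k /= -> ->] [k' /= -> ->];
    exists (a *: k + k') => //=.
  by rewrite linearP.
- exact: submod0.
- exact: submod_ker.
- exact: submod_im.
- by move=> _ [y <-] /=.
split=> [q _|q m _ [y fy] [k /= qk mk]].
  exists (submod_val (quotmod_repr q)); last by exists (quotmod_repr q);
    rewrite ?quotmod_reprK.
  by apply/eqP; exact: (valP (quotmod_repr q)).
rewrite /= qk -(linear0 (quotmod_pi (@im_in_kernel R L M N f g)));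
  apply/quotmod_piP.
by rewrite subr0 inE; exists y; rewrite fy.
Qed.

Lemma mem_torsion I M (m : M) : m \in @torsion R I M <->
  exists n, forall r : R, r \in ideal_exp I n -> r *: m = 0.
Proof. by rewrite inE. Qed.

Lemma exp_ideal_exp I (x : R) n : x \in I -> (x ^+ n : R) \in ideal_exp I n.
Proof.
move=> xI; elim: n => [|n IH] /=; rewrite inE => N sN; first exact: sN.
by apply: sN; exists x, (x ^+ n); rewrite exprS.
Qed.

Lemma Gamma_map_eq0 I M N (f : {linear M -> N}) (g : Gamma I M) :
  Gamma_map f g = 0 -> f (submod_val g) = 0.
Proof. by move=> fg0; have /= := congr1 (fun h => submod_val h) fg0. Qed.

Section Generators.
Variables (I : ideal R) (zs : seq R).
Hypothesis Izs : forall r : R, r \in I <-> gen (M := R^o) zs r.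

Lemma torsion_gens M (m : M) :
  (forall x, x \in zs -> x *: m \in @torsion R I M) -> m \in @torsion R I M.
Proof.
move=> tm.
have [n nP] : exists n, forall x, x \in zs ->
    forall r : R, r \in ideal_exp I n -> r *: (x *: m) = 0.
  elim: (zs) tm => [|x xs IH] tm; first by exists 0%N.
  have [|n nP] := IH; first by move=> y yxs; apply: tm; rewrite inE yxs orbT.
  have /mem_torsion[k kP] := tm x (mem_head _ _).
  exists (n + k)%N => y; rewrite inE => /orP[/eqP->|/nP ny] r rI.
    exact/kP/(ideal_exp_subset rI).
  by apply: ny; move: rI; rewrite addnC => /ideal_exp_subset.
apply/mem_torsion; exists n.+1 => r /=; rewrite inE.
have sA : submod (M := R^o) [set r : R | r *: m = 0].
  by split=> [|a u v /= u0 v0] /=;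
    rewrite ?scale0r // scalerDl -[(_ *: u) *: _]scalerA u0 v0 scaler0 addr0.
have [A AP] := submod_pack sA; move=> /(_ A) rA;
  apply/AP/rA => _ [x [y [xI yI ->]]].
apply/AP => /=; rewrite mulrC -scalerA.
move: xI => /Izs; apply: (@gen_min R R^o zs [set x : R | y *: (x *: m) = 0]).
  split=> [|a u v /= u0 v0] /=; first by rewrite scale0r scaler0.
  rewrite scalerDl scalerDr v0 addr0 -[(_ *: u) *: _]scalerA.
  by rewrite [LHS]scalerA mulrC -scalerA u0 scaler0.
by move=> x' x'zs; exact: nP.
Qed.

(** An element that is torsion for each generator is killed by a power of the
ideal. Instead of counting exponents in monomials, the induction turns the
generators one by one from those for which [m] is torsion into those which move
[m] into [Gamma_I M], starting from [torsion_gens]. *)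
Lemma torsion_tors M (m : M) : m \in @torsion R I M <-> tors zs m.
Proof.
split=> [/mem_torsion[n nP] x xzs|tm].
  by exists n; apply/nP/exp_ideal_exp/Izs/gen_mem.
suff : forall ws, {subset ws <= zs} -> forall m', tors ws m' ->
    (forall x, x \in zs -> x \notin ws -> x *: m' \in @torsion R I M) ->
      m' \in @torsion R I M.
  by move=> /(_ zs (fun _ => id) m tm); apply=> x ->.
elim=> [_ m' _ tm'|w ws IH wszs m' tw]; first by apply: torsion_gens => x /tm';
  exact.
have ws_zs : {subset ws <= zs} by move=> x xws; apply: wszs;
  rewrite inE xws orbT.
have [[k kw] tws] := (tors_cons w ws m').1 tw.
elim: k m' kw tws {tw} => [|k IHk] m' kw tws tm'.
  by move: kw; rewrite expr0 scale1r => ->; exact: rpred0.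
have twm : w *: m' \in @torsion R I M.
  apply: IHk; first by rewrite scalerA -exprSr.
    exact: submodZ (tors_submod _ _) tws.
  by move=> x xzs /(tm' x xzs) tx; rewrite scalerA mulrC -scalerA rpredZ.
apply: (IH ws_zs) => // x xzs xws; have [->//|xw] := eqVneq x w.
by apply: tm' => //; rewrite inE negb_or xw.
Qed.

Section Resolution.
Variables (T : lmodType R) (E : injective_resolution T).

Lemma ires_dd i m : ires_d E i.+1 (ires_d E i m) = 0.
Proof. by apply/ires_exact; exists m. Qed.

Definition ires_cochain : cochain R := Cochain ires_dd.

(** The cohomology of the resolution is [T] in degree zero. *)
Lemma serre_ires (Q : sqclass R) : serre Q -> Q T [set: T] [set 0] ->
  forall i, Q _ (cocyc R [::] ires_cochain i) (cobnd R [::] ires_cochain i).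
Proof.
move=> sQ QT i.
have sZ := cocyc_submod [::] ires_cochain i.
have sB := cobnd_submod [::] ires_cochain i.
have BZ := @cobnd_cocyc _ [::] ires_cochain i.
case: i sZ sB BZ => [|i] sZ sB BZ.
  apply: (serre_rel sQ (rho := [set p | ires_aug E p.2 = p.1])
    _ sZ sB (@submodT _ T) (submod0 T)) QT => //.
    split=> [|a [u u'] [v v'] /= <- <-] /=; first by rewrite linear0.
    by rewrite linearP.
  split=> [z [_ /ires_exact0[t tz]]|z t _ /= -> <-]; first by exists t.
  by rewrite linear0; exact: sB.1.
apply: (serre_rel sQ (rho :=
  [set p | p.2 = 0]) _ sZ sB (@submodT _ T) (submod0 T)) QT => //.
  by split=> // a [u u'] [v v'] /= -> ->; rewrite scaler0 addr0.
split=> [z Zz|z t [_ /ires_exact[y yz]] _ _]; first by exists 0.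
by exists y.
Qed.

Lemma artinian_local_cohomology : noetherian_ring R ->
  torsion_artinian zs [set: T] [set 0] ->
    forall i, artinian_module (local_cohomology I E i).
Proof.
move=> noethR wT i.
have artE : forall i, art (cocyc R zs ires_cochain i) (cobnd R zs ires_cochain
  i).
  apply: art_cohomology; last exact: serre_ires (serre_torsion_artinian zs) wT.
  by move=> j; exact/injective_divisible/ires_inj.
have valT j (g : Gamma I (E j)) : tors zs (submod_val g).
  by apply/torsion_tors; exact: valP.
have val0 j (g : Gamma I (E j)) : submod_val g = 0 -> g = 0.
  by move=> g0; apply: val_inj.
pose rho j : set (Gamma I (E j) * E j)%type := [set p | submod_val p.1 = p.2].
have srho j : submod (rho j).
  by split=> // a [u u'] [v v']; rewrite /rho /= => <- <-.
have sZ j (f : {linear Gamma I (E j) -> Gamma I (E j.+1)}) :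
  submod [set g | f g = 0].
  exact: submod_ker.
have sB j k (f : {linear Gamma I (E j) -> Gamma I (E k)}) :
  submod [set g | exists y, f y = g].
  exact: submod_im.
have gf0 j y : Gamma_map (ires_d E j.+1) (Gamma_map (ires_d E j) y) = 0 :> Gamma
  I (E j.+2).
  by apply: val0; rewrite /= ires_dd.
case: i => [|i] /=; apply: artinian_homology => //; first by move=> y /=;
  rewrite linear0.
  apply: (serre_rel (@serre_art R) (srho 0%N) (sZ _ _) (sB _ _ _)
    (cocyc_submod zs ires_cochain 0) (cobnd_submod zs ires_cochain 0) _ _ _
      (artE 0%N)).
  - by move=> _ [y <-] /=; rewrite linear0.
  - exact: (@cobnd_cocyc _ zs ires_cochain 0%N).
  split=> [g gZ|g m _ [y _ <-] gm].
    exists (submod_val g) => //; split; first exact: valT.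
    exact: (@Gamma_map_eq0 I _ _ (ires_d E 0) g gZ).
  by exists 0; rewrite linear0; apply/esym/val0; rewrite [submod_val g]gm.
  by move=> y; exact: gf0.
apply: (serre_rel (@serre_art R) (srho i.+1) (sZ _ _) (sB _ _ _)
    (cocyc_submod zs ires_cochain i.+1) (cobnd_submod zs ires_cochain i.+1) _ _
      _ (artE i.+1)).
- by move=> _ [y <-] /=; exact: gf0.
- exact: (@cobnd_cocyc _ zs ires_cochain i.+1).
split=> [g gZ|g m _ [y ty <-] gm].
  exists (submod_val g) => //; split; first exact: valT.
  exact: (@Gamma_map_eq0 I _ _ (ires_d E i.+1) g gZ).
have yI : y \in submod_pred (@torsion R I (E i)) by apply/torsion_tors.
by exists (Submod yI); apply: val_inj; exact: esym gm.
Qed.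
End Resolution.
End Generators.
End LocalCohomology.

(** * Tensor products and Tor *)

Section Resolutions.
Variable A : comNzRingType.
Implicit Types (M N P : lmodType A).

(** Lifting a projective module through a surjection, for linear relations: a
total relation out of a projective module contains the graph of a linear map. *)
Lemma projective_choice P M (rho : set (P * M)%type) :
  projective_module P -> submod rho -> (forall p, exists m, rho (p, m)) ->
  exists f : {linear P -> M}, forall p, rho (p, f p).
Proof.
move=> projP /submod_pack[N NP] total.
have [|f fP] := projP (submodule N) P (fst \o \val) idfun.
  move=> p; have [m pm] := total p.
  have Npm : (p, m) \in submod_pred N by apply/NP.
  by exists (Submod Npm).
exists (snd \o \val \o f) => p; apply/NP.
have -> : (p, (snd \o \val \o f) p) = submod_val (f p).
  by have /= := fP p; case: (submod_val (f p)) => u v /= ->.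
exact: valP.
Qed.

Lemma gen_lift M N (f : {linear M -> N}) (t : seq N) :
  (forall x, x \in t -> exists y, f y = x) ->
  exists s : seq M, forall x, gen t x -> exists2 y, gen s y & f y = x.
Proof.
elim: t => [_|a t IH tf].
  by exists [::] => _ ->; exists 0; rewrite ?linear0.
have [|s sP] := IH; first by move=> x xt; apply: tf; rewrite inE xt orbT.
have [b ba] := tf a (mem_head _ _).
exists (b :: s) => _ [r [w [/sP[y sy yw] ->]]]; exists (r *: b + y).
  by exists r, y.
by rewrite linearP ba yw.
Qed.

Variables (N : lmodType A) (P : projective_resolution N).

(** The module before the [i]th one and the differential into it; in degree zero
the differential is zero. *)
Definition pprev i : lmodType A := if i is j.+1 then P j else P 0.

Definition ppd i : {linear P i -> pprev i} :=
  match i return {linear P i -> pprev i} with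
  | 0 => (\0 : {linear P 0 -> P 0})
  | j.+1 => pres_d P j
  end.

(** [c] is homotopic, in degree [i], to a map with values in [S]. *)
Definition homotopic_into (c : A) i (S : set (P i)) : Prop :=
  exists (k : {linear pprev i -> P i}) (h : {linear P i -> P i.+1}),
    forall p, S (c *: p - k (ppd i p) - pres_d P i (h p)).

Lemma ppd_d i q : ppd i (pres_d P i q) = 0.
Proof.
by case: i q => [|i] q //=; apply/pres_exact; exists q.
Qed.

Lemma homotopic_into0 c (S : set (P 0)) : submod S ->
  (forall p, exists2 s, S s & pres_aug P s = pres_aug P (c *: p)) ->
  homotopic_into c S.
Proof.
move=> sS lift.
have [|||h hP] := @projective_choice (P 0) (P 1)
    [set p | S (c *: p.1 - pres_d P 0 p.2)].
- exact: pres_proj.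
- exact: (submod_preim (c \*: fst \- (pres_d P 0 \o snd))).
- move=> p; have [s Ss /eqP] := lift p.
  rewrite eq_sym -subr_eq0 -linearB => /eqP/pres_exact0[q qE].
  by exists q; rewrite /= qE subKr.
by exists \0, h => p; rewrite /= subr0; exact: hP.
Qed.

(** [c - h d] sends [P i.+1] to chains whose boundary lies in [S]. Lifting these
boundaries to [S'] leaves a cycle, which is the boundary of the next homotopy.
  *)
Lemma homotopic_intoS c i (S : set (P i)) (S' : set (P i.+1)) :
  submod S' ->
  (forall q, S (pres_d P i q) ->
    exists2 s, S' s & pres_d P i s = pres_d P i q) ->
  homotopic_into c S -> homotopic_into c S'.
Proof.
move=> sS' lift [k [h hP]].
have [|||h' h'P] := @projective_choice (P i.+1) (P i.+2)
    [set p | S' (c *: p.1 - h (pres_d P i p.1) - pres_d P i.+1 p.2)].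
- exact: pres_proj.
- exact: (submod_preim (c \*: fst \- (h \o pres_d P i \o fst) \-
    (pres_d P i.+1 \o snd))).
- move=> p; pose u := c *: p - h (pres_d P i p).
  have [|s Ss /eqP] := lift u.
    rewrite linearB linearZ /=; have := hP (pres_d P i p).
    by rewrite ppd_d linear0 subr0.
  rewrite eq_sym -subr_eq0 -linearB => /eqP/pres_exact[q qE].
  by exists q; rewrite /= qE subKr.
by exists h, h'.
Qed.

(** The boundaries in a finitely generated module of chains are finitely
generated, and so lift to a finitely generated module. This takes the place of
a comparison of [P] with a resolution by finitely generated modules. *)
Lemma homotopic_into_fg (t : seq N) : noetherian_ring A ->
  (forall n, gen t n) -> forall i, exists s, homotopic_into 1 (gen (M :=
    P i) s).
Proof.
move=> noethA tN; elim=> [|i [s hs]].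
  have [|s sP] := @gen_lift _ _ (pres_aug P) t.
    by move=> n _; exact: pres_aug_surj.
  exists s; apply: homotopic_into0; first exact: gen_submod.
  by move=> p; have [y sy yp] := sP _ (tN (pres_aug P p)); exists y;
    rewrite ?scale1r.
have [||t' tE] := @fg_sub _ (P i) s [set x | gen s x /\ exists q, pres_d P i q =
  x] noethA.
- by apply: submodI; [exact: gen_submod|exact: submod_im].
- by move=> x [].
have [|s' s'P] := @gen_lift _ _ (pres_d P i) t'.
  by move=> x /gen_mem; rewrite -tE => -[].
exists s'; apply: homotopic_intoS hs; first exact: gen_submod.
by move=> q sq; apply: s'P; rewrite -tE; split=> //; exists q.
Qed.

Lemma homotopic_into_null c : (forall n : N, c *: n = 0) ->
  forall i, homotopic_into c [set (0 : P i)].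
Proof.
move=> cN; elim=> [|i hi].
  apply: homotopic_into0; first exact: submod0.
  by move=> p; exists 0 => //; rewrite linear0 linearZ /= cN.
apply: homotopic_intoS hi; first exact: submod0.
by move=> q ->; exists 0 => //; rewrite linear0.
Qed.
End Resolutions.

Section TensorTor.
Variables (A B : comNzRingType) (phi : {rmorphism A -> B}).
Implicit Types (P Q : lmodType A) (T : lmodType B).
Local Notation tmap f T := (@tensor_map A B phi _ _ f T).

Lemma free_module_ind (K : choiceType) (X : set (free_module B K)) : submod X ->
  (forall k, X (free_gen B k)) -> forall g, X g.
Proof.
move=> sX Xgen g; rewrite (monalgE (g : {malg B[K]})).
elim/big_ind: _ => [|u v|k _]; [exact: sX.1|exact: submodD|].
have -> : << (g : {malg B[K]})@_k *g k >> = (g :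
  {malg B[K]})@_k *: free_gen B k.
  by apply/malgP => k'; rewrite mcoeffZ !mcoeffU mulrnAr mulr1.
exact: submodZ.
Qed.

Lemma tensor_ind P T (X : set (tensor phi P T)) : submod X ->
  (forall p t, X (tens phi p t)) -> forall z, X z.
Proof.
move=> sX Xt z; rewrite -[z]quotmod_reprK.
apply: (@free_module_ind _ [set g | X (quotmod_pi (mod_span (@tensor_rel _ _ phi
  P T)) g)]).
  split=> [|a u v Xu Xv] /=; first by rewrite linear0; exact: sX.1.
  by rewrite linearP; exact: sX.2.
by move=> [p t]; exact: Xt.
Qed.

Lemma tens0 P T (t : T) : tens phi (0 : P) t = 0.
Proof. by apply: (addrI (tens phi 0 t)); rewrite -tensDl !addr0. Qed.

Lemma tensB P T (p q : P) (t : T) :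
  tens phi (p - q) t = tens phi p t - tens phi q t.
Proof. by apply: (addIr (tens phi q t)); rewrite -tensDl !subrK. Qed.

Lemma tensor_map0 P Q T (z : tensor phi P T) :
  tmap (\0 : {linear P -> Q}) T z = 0.
Proof.
apply: (@tensor_ind P T [set z | tmap (\0 : {linear P -> Q}) T z = 0]).
  exact: submod_ker.
by move=> p t; rewrite /= tensor_map_tens /= tens0.
Qed.

(** The image of [S (x) T] in [P (x) T]. *)
Definition tens_im P T (S : set P) : set (tensor phi P T) :=
  [set w | forall X, submod X -> (forall s t, S s -> X (tens phi s t)) -> X w].

Lemma tens_im_submod P T S : submod (@tens_im P T S).
Proof.
split=> [X sX _|a u v Su Sv X sX SX]; first exact: sX.1.
by apply: sX.2; [exact: Su|exact: Sv].
Qed.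

Lemma tens_im0 P T : @tens_im P T [set 0] = [set 0].
Proof.
apply/seteqP; split=> [w|w ->]; last exact: (tens_im_submod _ _).1.
by apply; [exact: submod0|move=> _ t ->; exact: tens0].
Qed.

(** The image of [S (x) T] is filtered, along the generators of [S], by
quotients of [T]. *)
Lemma serre_tens_im (Q : sqclass B) P T (s : seq P) : serre Q ->
  Q T [set: T] [set 0] -> Q _ (@tens_im P T (gen s)) [set 0].
Proof.
move=> sQ QT; elim: s => [|a s IH].
  rewrite [gen _]/= tens_im0.
  apply: (serre_rel sQ (rho := [set p | p.2 = 0]) _ (submod0 _) (submod0 _)
    (submodT T) (submod0 T)) QT => //.
    by split=> // c [u u'] [v v'] /= -> ->; rewrite scaler0 addr0.
  by split=> // z _; exists 0.
have mono : tens_im (T := T) (gen s) `<=` tens_im (gen (a :: s)).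
  move=> w sw X sX asX; apply: sw => // y t sy; apply: asX.
  by exists 0, y; rewrite scale0r add0r.
have sS r : submod (@tens_im P T (gen r)) by exact: tens_im_submod.
apply: (serre_ext sQ (sS _) (sS s) (submod0 _)) => //; first by move=> _ ->;
  exact: (sS s).1.
apply: (serre_rel sQ (rho := [set p | tens_im (gen s) (p.1 - tens phi a p.2)])
  _ (sS _) (sS _) (submodT T) (submod0 T)) QT => //.
  have tensP c u v : tens phi a (c *: u + v) = c *: tens phi a u + tens phi a v
    :> tensor phi P T.
    by rewrite tensDr tensZr.
  split=> [|c [u u'] [v v'] /= Su Sv] /=.
    by rewrite -(scale0r (0 : T)) tensZr scale0r subr0; exact: (sS s).1.
  by rewrite tensP opprD addrACA -scalerBr; exact: (sS s).2.
split=> [w|w t _ /= ->]; last first.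
  by rewrite -(scale0r (0 : T)) tensZr scale0r subr0.
move/(_ [set w | exists2 t, [set: T] t & tens_im (gen s) (w - tens phi a t)]);
  apply; last first.
  move=> _ t [r [y [sy ->]]]; exists (phi r *: t) => //=.
  rewrite tensDl tensZl addrAC subrr add0r => X sX; exact.
split; first by exists 0 => //=;
  rewrite -(scale0r (0 : T)) tensZr scale0r subr0; exact: (sS s).1.
move=> c u v [t _ /= ut] [t' _ /= vt]; exists (c *: t + t') => //=.
by rewrite tensDr tensZr opprD addrACA -scalerBr; exact: (sS s).2.
Qed.

Lemma tensor_homotopy N (P : projective_resolution N) T c i (S : set (P i)) :
  homotopic_into c S ->
  exists h : {linear tensor phi (P i) T -> tensor phi (P i.+1) T},
    forall z, tmap (ppd P i) T z = 0 ->
    tens_im S (phi c *: z - tmap (pres_d P i) T (h z)).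
Proof.
move=> [k [h hP]]; exists (tmap h T) => z dz.
suff : tens_im S (phi c *: z - tmap k T (tmap (ppd P i) T z)
    - tmap (pres_d P i) T (tmap h T z)).
  by rewrite dz linear0 subr0.
move: z {dz}; apply: tensor_ind => [|p t] /=; last first.
  by rewrite !tensor_map_tens -tensZr -tensZl -!tensB => X sX; exact.
exact: (submod_preim (phi c \*: idfun \- (tmap k T \o tmap (ppd P i) T) \-
  (tmap (pres_d P i) T \o tmap h T)) (tens_im_submod T S)).
Qed.

Section Tor.
Variables (I : ideal A) (zs : seq B) (T : lmodType B).
Hypothesis Izs : forall r : B, r \in zs -> r \in ideal_ext phi I.
Variable P : projective_resolution (quotmod I).

Lemma artinian_Tor i : noetherian_ring A ->
  torsion_artinian zs [set: T] [set 0] ->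
  artinian_module (Tor phi P T i).
Proof.
move=> noethA wT; 
pose Z : set (tensor phi (P i) T) := [set z | tmap (ppd P i) T z = 0].
pose Bd : set (tensor phi (P i) T) :=
  [set z | exists y, tmap (pres_d P i) T y = z].
have sZ : submod Z by exact: submod_ker.
have sBd : submod Bd by exact: submod_im.
have BdZ : Bd `<=` Z.
  move=> _ [y <-]; rewrite /Z /=.
  apply: (@tensor_ind (P i.+1) T [set y | tmap (ppd P i) T
    (tmap (pres_d P i) T y) = 0]).
    exact: (submod_ker (tmap (ppd P i) T \o tmap (pres_d P i) T)).
  by move=> p t /=; rewrite !tensor_map_tens ppd_d tens0.
have artZ : art Z Bd.
  have [|s hs] := @homotopic_into_fg _ _ P [:: quotmod_pi I 1] noethA _ i.
    move=> n; exists (quotmod_repr n : A), 0; split=> //.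
    rewrite addr0 -[LHS]quotmod_reprK -linearZ; congr quotmod_pi.
    by rewrite /GRing.scale /= mulr1.
  have [h hP] := tensor_homotopy T hs.
  have wZ : torsion_artinian zs Z Bd.
    apply: (serre_rel (serre_torsion_artinian zs) (rho :=
      [set p | Bd (p.1 - p.2)]) _ sZ sBd
      (tens_im_submod T (gen s)) (submod0 _) BdZ)
      (serre_tens_im s (serre_torsion_artinian zs) wT).
    - split=> [|a [u u'] [v v'] /= Bu Bv] /=; first by rewrite subr0;
        exact: sBd.1.
      by rewrite opprD addrACA -scalerBr; exact: sBd.2.
    - by move=> _ ->; exact: (tens_im_submod T _).1.
    split=> [z /hP|z _ _ -> /=]; last by rewrite subr0.
    rewrite rmorph1 scale1r => hz; eexists; first exact: hz.
    by exists (h z); rewrite subKr.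
  apply: wZ => // x /Izs; rewrite inE.
  have [J JP] := submod_pack (torsq_ideal sZ sBd).
  move=> /(_ J) xJ; apply/JP/xJ => _ [c cI <-]; apply/JP => z Zz.
  have cN (n : (quotmod I : lmodType A)) : (c : A) *: n = 0.
    rewrite -[n]quotmod_reprK -linearZ -(linear0 (quotmod_pi I)).
    apply/quotmod_piP; rewrite subr0.
    by have /= := submodZ (quotmod_repr n : A) (submod_mem I) cI;
      rewrite /GRing.scale /= mulrC.
  have [h' h'P] := tensor_homotopy T (homotopic_into_null P cN i).
  exists 1%N; rewrite expr1; have := h'P z Zz; rewrite tens_im0 => /eqP.
  by rewrite subr_eq0 => /eqP->; exists (h' z).
case: i @Z @Bd sZ sBd BdZ artZ => [|i] Z Bd sZ sBd BdZ artZ /=;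
  apply: artinian_homology => //.
- suff -> : [set m : tensor phi (P 0) T | \0 m = 0 :> tensor phi (P 0) T] = Z by
    [].
  by apply/seteqP; split=> z //= _; rewrite /Z /= tensor_map0.
- by move=> y; apply: (BdZ); exists y.
Qed.
End Tor.
End TensorTor.

(** * Graded rings *)

Section Graded.
Variables (R : comNzRingType) (G : ring_grading R).
Local Notation R0 := (base_ring G).
Local Notation phi := (base_incl G).

Lemma base_decomposition r :
  exists (r0 : R0) (rp : R), rp \in irrelevant G /\ r = phi r0 + rp.
Proof.
have [s [y [_ yG ->]]] := (rcomp_direct G).1 r.
elim/big_rec: _ => [|i _ _ [r0 [rp [rpP ->]]]].
  by exists 0, 0; rewrite rmorph0 addr0; split=> //;
    exact: (submod_mem (irrelevant G)).1.
case: i (yG i) => [|i] yiG.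
  by exists (BaseRing yiG + r0), rp; rewrite rmorphD addrA.
exists r0, (y i.+1 + rp); rewrite addrCA; split=> //.
apply: (submodD (submod_mem (irrelevant G))) rpP.
rewrite /= inE; exists [:: y i.+1]; rewrite big_seq1; split=> // z.
by rewrite inE => /eqP->; exists i.+1.
Qed.

Lemma maximal_ideal_inverse (A : comNzRingType) (m : ideal A) (r : A) :
  maximal_ideal m -> r \in m \/ exists c, c * r - 1 \in m.
Proof.
move=> [_ mmax].
have [|J JP] := @submod_pack A A^o [set x : A | exists c, x - c * r \in m].
  split; first by exists 0; rewrite mul0r subr0; exact: (submod_mem m).1.
  move=> a x y [c xc] [d yd]; exists (a * c + d).
  rewrite mulrDl -mulrA opprD addrACA -[a *: x - _](scalerBr a).
  exact: ((submod_mem m).2 a _ _ xc yd).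
have [J1|Jproper] := boolP ((1 : A^o) \in J).
  right; move/JP: J1 => [c mc]; exists c.
  by have := submodZ (-1) (submod_mem m) mc; rewrite /= scaleN1r opprB.
left; rewrite -(mmax J Jproper) => [|x xm]; apply/JP.
  by exists 1; rewrite mul1r subrr; exact: (submod_mem m).1.
by exists 0; rewrite mul0r subr0.
Qed.

Variables (m0 a0 b0 : ideal R0).
Hypotheses (noethR : noetherian_ring R) (noethR0 : noetherian_ring R0).
Hypothesis m0max : maximal_ideal m0.

Lemma base_gen (ys : seq R) : submod (M := R0^o) [set r | gen (M :=
  R^o) ys (phi r)].
Proof.
have [y0 yP] := @gen_submod R R^o ys.
split=> [|a u v yu yv]; rewrite /mkset ?rmorph0 //.
by rewrite rmorphD rmorphM; exact: yP.
Qed.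

(** The ideal [m0 + R_+] is maximal in [R] because its quotient is [R0 / m0]. *)
Lemma graded_maximal_gens : exists ys : seq R,
  (forall r, gen (M := R^o) ys r \/ exists r', gen (M :=
    R^o) ys (r' * r - 1)) /\
  (forall y, y \in ys -> y \in irrelevant G \/ exists2 x, x \in m0 & y = phi x).
Proof.
have [ms msE] := fin_genP (noethR0 m0).
have [ws wsE] := fin_genP (noethR (irrelevant G)).
pose ys : seq R := [seq phi m | m <- ms] ++ ws.
have sys := @gen_submod R R^o ys.
have irr_ys w : w \in irrelevant G -> gen (M := R^o) ys w.
  move=> wI; apply: (@gen_mono _ R^o ws); first by move=> z zs;
    rewrite mem_cat zs orbT.
  by rewrite -wsE.
have m0_ys x : x \in m0 -> gen (M := R^o) ys (phi x).
  move=> xm; have : gen (M := R0^o) ms x by rewrite -msE.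
  apply: (gen_min (base_gen ys)) => z zms; apply: gen_mem.
  by rewrite mem_cat map_f.
exists ys; split=> [r|y]; last first.
  rewrite mem_cat => /orP[/mapP[x xms ->]|/(@gen_mem _ R^o)];
    last by rewrite -wsE; left.
  by right; exists x => //; move/(@gen_mem _ R0^o): xms; rewrite -msE.
have [r0 [rp [rpP ->]]] := base_decomposition r.
have [r0m|[c cm]] := maximal_ideal_inverse r0 m0max.
  by left; apply: (submodD sys); [exact: m0_ys|exact: irr_ys].
right; exists (phi c); rewrite mulrDr addrAC.
apply: (submodD sys); last exact/(submodZ (phi c) sys)/irr_ys.
by have := m0_ys _ cm; rewrite rmorphB rmorphM rmorph1.
Qed.

Variable T : lmodType R.
Hypothesis m0_radical : forall x : R0, x \in m0 ->
  exists n, (x ^+ n : R0) \in ideal_add a0 b0.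
Hypothesis torsT :
  torsion_module (ideal_add (ideal_ext phi a0) (irrelevant G)) T.

(** The module [T] being torsion for [a0] and [R_+], a subquotient that is
torsion for [b0] is torsion for [a0 + b0 + R_+], and [m0] is the radical of
[a0 + b0]. *)
Lemma graded_torsq (zs : seq R) (Z B : set T) :
  (forall r : R, r \in ideal_ext phi b0 <-> gen (M := R^o) zs r) ->
  submod Z -> submod B -> (forall x, x \in zs -> torsq x Z B) ->
  forall y, y \in irrelevant G \/ (exists2 x, x \in m0 & y = phi x) ->
    torsq y Z B.
Proof.
move=> zsE sZ sB tzs; have sD := torsq_ideal sZ sB.
have extP (I : ideal R0) x : x \in I -> phi x \in ideal_ext phi I.
  by move=> xI; rewrite inE => N; apply; exists x.
have tb x : x \in b0 -> torsq (phi x) Z B.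
  by move=> /extP/zsE; exact: (gen_min sD).
have ta r : r \in ideal_add (ideal_ext phi a0) (irrelevant G) -> torsq r Z B.
  move=> ra z _; have /mem_torsion[n nP] := torsT z.
  by exists n; rewrite nP; [exact: sB.1|exact: exp_ideal_exp].
have tirr r : r \in irrelevant G -> torsq r Z B.
  move=> rI; apply: ta; rewrite inE; exists 0, r; rewrite add0r; split=> //.
  exact: (submod_mem (ideal_ext phi a0)).1.
have ta0 x : x \in a0 -> torsq (phi x) Z B.
  move=> xa; apply: ta; rewrite inE; exists (phi x), 0; rewrite addr0.
  by split=> //; [exact: extP|exact: (submod_mem (irrelevant G)).1].
move=> y [/tirr//|[x /m0_radical[n]]];
  rewrite inE => -[u [v [ua vb xE]]] -> z Zz.
have [k Bk] : exists k, B ((phi x ^+ n) ^+ k *: z).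
  rewrite -rmorphXn [_ ^+ n]xE rmorphD.
  by have := submodD sD (ta0 _ ua) (tb _ vb); apply.
by exists (n * k)%N; rewrite exprM.
Qed.
End Graded.

Theorem theorem1p2 (R : comNzRingType) (G : ring_grading R)
    (noethR : noetherian_ring R)
    (noethR0 : noetherian_ring (base_ring G))
    (m0 : ideal (base_ring G)) (localR0 : local_with m0)
    (a0 b0 : ideal (base_ring G)) (a0_proper : is_proper_ideal a0)
    (primary_ab : primary_to m0 (ideal_add a0 b0))
    (T : lmodType R) (gradT : module_grading G T)
    (torsT : torsion_module
               (ideal_add (ideal_ext (base_incl G) a0) (irrelevant G)) T)
    (minimaxT : minimax_module T) :
  forall i : nat,
    (forall E : injective_resolution T,
       artinian_module (local_cohomology (ideal_ext (base_incl G) b0) E i)) /\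
    (forall P : projective_resolution (quotmod b0),
       artinian_module (Tor (base_incl G) P T i)).
Proof.
have [zs zsE] := fin_genP (noethR (ideal_ext (base_incl G) b0)).
have Izs (r : R) : r \in ideal_ext (base_incl G) b0 <-> gen (M := R^o) zs r.
  by rewrite -zsE.
have m0_radical x : x \in m0 -> exists n, (x ^+ n) \in ideal_add a0 b0.
  by move/primary_ab.2.
have [ys [ysmax ysP]] := graded_maximal_gens noethR noethR0 localR0.1.
have wT : torsion_artinian zs [set: T] [set 0].
  apply: (minimax_torsion_artinian noethR ysmax) minimaxT => Z B sZ sB tzs y
    /ysP.
  exact: (graded_torsq m0_radical torsT Izs sZ sB tzs).
move=> i; split=> [E|P]; first exact: (@artinian_local_cohomology _ _ _ Izs _ E
  noethR wT i).
have zsI (r : R) : r \in zs -> r \in ideal_ext (base_incl G) b0.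
  by move=> /(@gen_mem _ R^o)/Izs.
exact: (@artinian_Tor _ _ _ _ _ _ zsI P i noethR0 wT).
Qed.
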